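(* (1) Let $1<p<q$ be integers with $\gcd(p,q)=1$ and $q-p>1$, and let $C\subset \mathbb{CP}^2$ be the rational bicuspidal curve parametrized by $z\mapsto [z^p:z^q:1]$, $z\in\mathbb{C}\sqcup\{\infty\}$. Let $G_0$ (resp. $G_\infty$) be the gap of the rational unicuspidal curve obtained from $C$ by resolving the singularity at $z=0$ (resp. at $z=\infty$). Then the following are the only possibilities, where cases (i) and (ii) are mutually exclusive: (i) if $p>2$ and $p\mid (q+1)$, then $G_0=0$ and $G_\infty=1$; (ii) if $q-p>2$ and $(q-p)\mid (q+1)$, then $G_0=1$ and $G_\infty=0$; (iii) in all other cases, $G_0=G_\infty=0$. (2) Let $1<p<q$ be integers with $\gcd(p,q)=1$, let $\alpha$ be a positive integer with $q<\alpha p$, and let $C\subset \mathbb{CP}^1\times\mathbb{CP}^1$ be the rational bicuspidal curve parametrized by $z\mapsto ([z^p:1],[z^q+z^{\alpha p}:1])$, $z\in\mathbb{C}\sqcup\{\infty\}$. Let $G_0$ (resp. $G_\infty$) be the gap of the rational unicuspidal curve obtained from $C$ by resolving the singularity at $z=0$ (resp. at $z=\infty$). If $p>2$, then the following are the only possibilities, where cases (i), (ii) and (iii) are mutually exclusive: (i) if $q-p=1$, then $G_0=0$ and $G_\infty=2$; (ii) if $q-p>1$ and $p\mid (q-1)$, then $G_0=0$ and $G_\infty=1$; (iii) if $p\mid (q+1)$, then $G_0=1$ and $G_\infty=0$; (iv) in all other cases, $G_0=G_\infty=0$. If $p=2$ and $q=3$, then $G_0=0$ and $G_\infty=1$; if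 $p=2$ and $q>3$, then $G_0=G_\infty=0$.
   Context: For co-prime integers $1<a<b$, set $$m_{a,b}:=ab+\max\left(\left\lfloor \frac{a}{a-a'}\right\rfloor,\left\lfloor \frac{b}{b-b'}\right\rfloor\right),$$ where $a',b'$ are the integers uniquely determined by $1\le a'<a$, $1\le b'<b$ and $ab'+ba'=ab+1$. A cuspidal singularity with one Puiseux pair $(a,b)$ is a unibranch (locally irreducible) plane curve singularity of the topological type of $\{x^a=y^b\}$ at the origin. A rational unicuspidal (resp. bicuspidal) curve is an irreducible compact curve in a smooth surface whose normalization is $\mathbb{CP}^1$ and which has exactly one (resp. two) singular points, all of them cuspidal (unibranch). For a rational unicuspidal curve $D$ with one Puiseux pair $(a,b)$ in an algebraic surface, the gap of $D$ is $m_{a,b}-D\cdot D$, where $D\cdot D$ is the self-intersection number of $D$ in the surface containing it. The curve in $\mathbb{CP}^2$ of part (1) has two cuspidal singularities: at $z=0$, with one Puiseux pair $(p,q)$, and at $z=\infty$, with one Puiseux pair $(q-p,q)$. The curve in $\mathbb{CP}^1\times\mathbb{CP}^1$ of part (2) has two cuspidal singularities: at $z=0$, with one Puiseux pair $(p,q)$, and at $z=\infty$, with one Puiseux pair $(p,2\alpha p-q)$. Resolving a singularity of $C$ means blowing up the ambient surface repeatedly at the singular point (and the singular points of the successive proper transforms lying over it) until the proper transform first becomes smooth there (minimal resolution, not normal crossing resolution). The resulting curve is the proper transform of $C$ in the blown-up surface; it is a rational unicuspidal curve whose only singularity is the other singularity of $C$, and the gap is computed using the self-intersection of this proper transform in the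 blown-up surface. *)

(* Defs.v *)
From mathcomp Require Import all_boot all_order all_algebra.
From mathcomp Require Import generic_quotient fraction.
From mathcomp Require Import classical_sets fsbigop.

Set Implicit Arguments.
Unset Strict Implicit.
Unset Printing Implicit Defensive.

Import Order.TTheory GRing.Theory Num.Theory.
Local Open Scope classical_set_scope.
Local Open Scope ring_scope.
Local Open Scope quotient_scope.

(* Smooth rational surfaces are handled as Zariski models inside the field
   L = K(x, y) of rational functions: a point of a surface is recorded by a
   pair (u, v) of elements of L forming algebraic coordinates centred at that
   point. The pair determines the local ring of the point,
   { N(u, v) / M(u, v) | N, M in K[U, V], M(0, 0) <> 0 }, and a surface is the
   set of these pairs, with exactly one pair for each of its points.
   Rational curves are handled through their normalization P^1 -> X. *)

Notation ratfun1 K := {fraction {poly K}}.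
Notation ratfun2 K := {fraction {poly {poly K}}}.
Local Notation "x %:F" := (tofrac x).

Section Surfaces.
Variable K : fieldType.

Local Notation L := (ratfun2 K).
Local Notation Kz := (ratfun1 K).

(* P^1 = K + {oo}, with None standing for oo. *)
Definition P1 := option K.

Definition chart := (L * L)%type.
Definition surface := set chart.

(* The curve parametrized by z |-> (D.1 z, D.2 z) in the coordinates (x, y).
   The parametrization is meant to be birational onto its image, so that P^1
   is the normalization of the curve. *)
Definition curve := (Kz * Kz)%type.

Definition const1 (k : K) : Kz := (k%:P)%:F.
Definition const2 (k : K) : L := (k%:P%:P)%:F.

Definition xL : L := 'X%:F.
Definition yL : L := ('X%:P)%:F.
Definition base_chart : chart := (xL, yL).

(* A polynomial f : {poly {poly K}} in the variables (U, V) has U as its outer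
   variable: f`_i`_j is the coefficient of U^i V^j. *)
Definition eval2 (E : fieldType) (iota : K -> E) (f : {poly {poly K}})
    (u v : E) : E :=
  (map_poly (map_poly iota) f).[u%:P].[v].

(* The convention ord s 0 = 0 is harmless: orders of vanishing are only read
   off nonzero functions, cf. vanishes_at. *)
Definition ord (s : P1) (r : Kz) : int :=
  let n := \n_(repr r) in let d := \d_(repr r) in
  if r == 0 then 0 else
  match s with
  | Some z => (mup z n)%:Z - (mup z d)%:Z
  | None => (size d)%:Z - (size n)%:Z
  end.

Definition vanishes_at (s : P1) (r : Kz) : Prop := r = 0 \/ 0 < ord s r.

(* The rational function w on the surface has no pole along the curve D, and r
   is its pull-back to the normalization P^1 of D. *)
Definition restricts (D : curve) (w : L) (r : Kz) : Prop :=
  exists N M : {poly {poly K}},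
    [/\ w = N%:F / M%:F, eval2 const1 M D.1 D.2 != 0
      & r = eval2 const1 N D.1 D.2 / eval2 const1 M D.1 D.2].

Definition restrict (D : curve) (w : L) : Kz := xget 0 (restricts D w).

Definition passes_through (D : curve) (s : P1) (c : chart) : Prop :=
  exists ru rv : Kz,
    [/\ restricts D c.1 ru, restricts D c.2 rv, vanishes_at s ru
      & vanishes_at s rv].

(* The point of X which is the image of s under P^1 -> X. *)
Definition point_at (X : surface) (D : curve) (s : P1) : chart :=
  xget (0, 0) [set c | X c /\ passes_through D s c].

(* f generates the ideal of D in the polynomial ring K[u, v] of the chart. *)
Definition is_equation (D : curve) (c : chart) (f : {poly {poly K}}) : Prop :=
  exists ru rv : Kz,
    [/\ restricts D c.1 ru, restricts D c.2 rv
      & forall g : {poly {poly K}},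
          eval2 const1 g ru rv = 0 <-> exists h, g = h * f].

Definition equation (D : curve) (c : chart) : {poly {poly K}} :=
  xget 0 (is_equation D c).

Definition equation_in_L (D : curve) (c : chart) : L :=
  eval2 const2 (equation D c) c.1 c.2.

(* D . D = deg O_X(D)|_D, computed on the normalization. With F the equation of
   D in the coordinates (x, y) and f_s a local equation of D at the image of s,
   the divisor of 1 / F is -D plus components other than D; hence 1 / F is a
   rational section of O_X(D) whose restriction to D is, near s, the function
   (f_s / F)|_D in the local frame 1 / f_s. *)
Definition self_intersection (X : surface) (D : curve) : int :=
  \sum_(s \in [set: P1])
    ord s (restrict D (equation_in_L D (point_at X D s)
                       / equation_in_L D base_chart)).

(* The curve D in X is smooth at the image of s: the linear part of its local
   equation there is nonzero. *)
Definition smooth_at (X : surface) (D : curve) (s : P1) : Prop :=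
  let f := equation D (point_at X D s) in f`_1`_0 != 0 \/ f`_0`_1 != 0.

(* The exceptional curve is { (u, v / u - k) | k in K } plus (u / v, v). *)
Definition blowup (X : surface) (c : chart) : surface :=
  [set d | X d /\ d <> c]
  `|` [set d | exists k : K, d = (c.1, c.2 / c.1 - const2 k)]
  `|` [set (c.1 / c.2, c.2)].

Definition blowups (X : surface) (D : curve) (s : P1) (n : nat) : surface :=
  iter n (fun Y => blowup Y (point_at Y D s)) X.

(* Minimal resolution of the unibranch singularity of D at the image of s. The
   proper transform of D has the same parametrization D. *)
Definition resolution_length (X : surface) (D : curve) (s : P1) : nat :=
  xget 0%N [set n | smooth_at (blowups X D s n) D s
    /\ forall k, (k < n)%N -> ~ smooth_at (blowups X D s k) D s].

Definition resolve (X : surface) (D : curve) (s : P1) : surface :=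
  blowups X D s (resolution_length X D s).

(* The branch of D at s has the topological type of x^a = y^b, with a < b: in
   suitable local coordinates (g, h) of the surface it is parametrized by
   (t^a, c t^b + higher order terms), c <> 0. Only the orders of g and h matter,
   so g and h can be taken polynomial in the coordinates of the chart. *)
Definition has_puiseux_pair (X : surface) (D : curve) (s : P1) (a b : nat) :
    Prop :=
  let c := point_at X D s in
  [/\ (1 < a < b)%N, coprime a b &
  exists g h : {poly {poly K}},
    [/\ g`_0`_0 = 0, h`_0`_0 = 0,
        g`_1`_0 * h`_0`_1 - g`_0`_1 * h`_1`_0 != 0,
        ord s (restrict D (eval2 const2 g c.1 c.2)) = a%:Z
      & ord s (restrict D (eval2 const2 h c.1 c.2)) = b%:Z]].

Definition puiseux_pair (X : surface) (D : curve) (s : P1) : nat * nat :=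
  xget (0%N, 0%N) [set ab | has_puiseux_pair X D s ab.1 ab.2].

(* The parameter of the singular point of a unicuspidal curve. *)
Definition cusp (X : surface) (D : curve) : P1 :=
  xget None [set s | ~ smooth_at X D s].

(* Points [a : b : 1], then [1 : b : 0], then [0 : 1 : 0], where x and y are
   the first two homogeneous coordinates divided by the third. *)
Definition CP2 : surface :=
  [set d | exists a b : K, d = (xL - const2 a, yL - const2 b)]
  `|` [set d | exists b : K, d = (xL^-1, yL / xL - const2 b)]
  `|` [set (yL^-1, xL / yL)].

(* Points ([a : 1], [b : 1]), then ([1 : 0], [b : 1]), ([a : 1], [1 : 0]) and
   ([1 : 0], [1 : 0]). *)
Definition CP1xCP1 : surface :=
  [set d | exists a b : K, d = (xL - const2 a, yL - const2 b)]
  `|` [set d | exists b : K, d = (xL^-1, yL - const2 b)]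
  `|` [set d | exists a : K, d = (xL - const2 a, yL^-1)]
  `|` [set (xL^-1, yL^-1)].

End Surfaces.

Definition m_primes (a b : nat) : nat * nat :=
  xget (0%N, 0%N)
    [set ab | [/\ (1 <= ab.1 < a)%N, (1 <= ab.2 < b)%N
                & (a * ab.2 + b * ab.1 = a * b + 1)%N]].

Definition m (a b : nat) : nat :=
  let: (a', b') := m_primes a b in
  (a * b + maxn (a %/ (a - a')) (b %/ (b - b')))%N.

(* For a rational unicuspidal curve D with one Puiseux pair in X. *)
Definition gap (K : fieldType) (X : surface K) (D : curve K) : int :=
  let: (a, b) := puiseux_pair X D (cusp X D) in
  (m a b)%:Z - self_intersection X D.

(* z |-> [z^p : z^q : 1]. *)
Definition curve1 (K : fieldType) (p q : nat) : curve K :=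
  (('X^p)%:F, ('X^q)%:F).

(* z |-> ([z^p : 1], [z^q + z^(alpha p) : 1]). *)
Definition curve2 (K : fieldType) (p q alpha : nat) : curve K :=
  (('X^p)%:F, ('X^q + 'X^(alpha * p))%:F).

(* Main.v *)
(* Blowing up a point where D has multiplicity mu divides the local equation by
   the mu-th power of the exceptional equation and so lowers D . D by mu^2. For a
   germ parametrized by functions of coprime orders (A, B) this is one step of
   the subtractive Euclidean algorithm on (A, B), until one order is 1. If the
   other one is then r, resolving lowers D . D by A B - r in total. Hence both
   gaps are differences max(floor(a / (a - a')), floor(b / (b - b'))) - r, where
   (a, b) is the pair of the remaining cusp and r comes from the resolved one.
   Running the Euclidean algorithm backwards with the Farey neighbours attached
   to (a', b') shows that the maximum is the final value r of the pair (a, b)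
   itself, plus one in the cases a > 2, a | b + 1 and b = a + 1. It remains to
   compare the values r of (p, q) and (q - p, q), which agree, and of (p, q) and
   (p, 2 alpha p - q), which differ only if p divides q - 1 or q + 1. *)

Require Import Defs.
From HB Require Import structures.
From mathcomp Require Import all_boot all_order all_algebra.
From mathcomp Require Import generic_quotient fraction polyXY.
From mathcomp Require Import complex.
From mathcomp Require Import classical_sets fsbigop.
From mathcomp Require Import reals.
From mathcomp Require Import ring zify.

Set Implicit Arguments.
Unset Strict Implicit.
Unset Printing Implicit Defensive.

Import Order.TTheory GRing.Theory Num.Theory.
Local Open Scope ring_scope.

(** All geometric objects are defined by choice: the point under a parameter, the local equation,
    the restriction of a function, the cusp, the Puiseux pair, the number of blow-ups. Each
    computation therefore needs a uniqueness proof, and this shapes the geometric half. A chart is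
    followed through the blow-ups together with the pull-backs of its two coordinates, an explicit
    generator of the ideal of the curve, and the order at s of its quotient by the affine equation;
    this order is the summand of D . D at s. The summand vanishes except at the two cusps, where it
    starts as 0 and as the full self-intersection (q^2 in the plane, 2 alpha p^2 in the quadric).
    The germs at z = 0, and at infinity in the plane, have a Newton polygon that is one edge with
    coprime ends, a form stable under blowing up. At infinity in the quadric the coordinates have
    orders p and alpha p, which are not coprime, and alpha blow-ups of multiplicity p are needed
    before that form appears, with exponents p and alpha p - q. *)

Local Notation "x %:F" := (tofrac x).

(** * Orders of vanishing *)

Lemma fraction_repr (A : idomainType) (x : {fraction A}) :
  x = (frac (repr x)).1%:F / (frac (repr x)).2%:F.
Proof.
have d0 := denom_ratioP (repr x).
apply: (canRL (mulfK _)); first by rewrite tofrac_eq0.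
rewrite -{1}[x]reprK; unlock tofrac.
rewrite -[LHS]FracField.pi_mul.
apply/eqmodP => /=; rewrite FracField.equivfE /FracField.mulf.
by rewrite /= !numden_Ratio ?mulf_neq0 ?oner_eq0 // !mulr1 mulrC.
Qed.

Lemma divf_neq0 (F : fieldType) (x y : F) : x != 0 -> y != 0 -> x / y != 0.
Proof. by move=> x0 y0; rewrite mulf_neq0 ?invr_eq0. Qed.

Lemma fractionP (A : idomainType) (x : {fraction A}) :
  exists n d, d != 0 /\ x = n%:F / d%:F.
Proof. by eexists; eexists; split; [|exact: fraction_repr]; exact: denom_ratioP. Qed.

(** At infinity this is - deg f - 1, since [ord] compares sizes rather than degrees. The shift
    cancels in quotients; in products the term [pord s 1] repairs it. *)
Definition pord (K : fieldType) (s : P1 K) (f : {poly K}) : int :=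
  if s is Some z then (mup z f)%:Z else - (size f)%:Z.

(* [lia] does not identify integer atoms that are only convertible. *)
Ltac ord_lia :=
  repeat match goal with
  | |- context [ord ?s ?x] => move: (ord s x) => ?
  | |- context [pord ?s ?x] => move: (pord s x) => ?
  end; lia.

Section Valuation.
Variable K : fieldType.
Implicit Types (s : P1 K) (f g : {poly K}) (r : ratfun1 K).

Lemma pordM s f g : f != 0 -> g != 0 ->
  pord s (f * g) + pord s 1 = pord s f + pord s g.
Proof.
move=> f0 g0; case: s => [z|] /=.
  by rewrite mupM // (mupNroot (root1 z)) PoszD addr0.
have : (0 < size f)%N by rewrite size_poly_gt0.
by rewrite size_mul // size_poly1; move: (size f) (size g) => a b; lia.
Qed.

Lemma mupD z f g : f + g != 0 -> f != 0 -> g != 0 ->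
  (minn (mup z f) (mup z g) <= mup z (f + g))%N.
Proof.
move=> fg0 f0 g0; rewrite mup_geq // dvdp_add //.
  by rewrite -mup_geq // geq_minl.
by rewrite -mup_geq // geq_minr.
Qed.

Lemma pordD s f g (k : int) : f + g != 0 -> f != 0 -> g != 0 ->
  k <= pord s f -> k <= pord s g -> k <= pord s (f + g).
Proof.
move=> fg0 f0 g0; case: s => [z|] /=.
  by have := mupD z fg0 f0 g0; lia.
have := size_polyD f g; rewrite leq_max; move: (size f) (size g) (size (f + g)%R) => a b c; lia.
Qed.

(** [ord] looks at one chosen representative of the fraction. Cross-multiplying with any other
    fraction for the same function shows that the choice does not matter. *)
Lemma pord_neq0 s f g : f != 0 -> g != 0 -> ord s (f%:F / g%:F) = pord s f - pord s g.
Proof.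
move=> f0 g0; rewrite /ord; set r := _ / _.
have r0 : r != 0 by rewrite mulf_neq0 ?invr_eq0 ?tofrac_eq0.
rewrite (negPf r0).
have d0 := denom_ratioP (repr r).
have E := fraction_repr r.
have n0 : (frac (repr r)).1 != 0.
  by apply: contraNneq r0 => n0; rewrite E n0 tofrac0 mul0r.
have : f * (frac (repr r)).2 = (frac (repr r)).1 * g.
  apply/eqP; rewrite -tofrac_eq !tofracM.
  by rewrite -eqr_div ?tofrac_eq0 // -E.
move=> /(congr1 (pord s)) /(congr1 (fun x => x + pord s 1)).
rewrite !pordM // => Epord.
have -> : pord s f - pord s g = pord s (frac (repr r)).1 - pord s (frac (repr r)).2.
  by move: Epord; move: (pord s) => o; lia.
by case: s {Epord} => [z|] //=; rewrite opprK addrC.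
Qed.

Lemma ord_0 s : ord s (0 : ratfun1 K) = 0.
Proof. by rewrite /ord eqxx. Qed.

Lemma ratfun1P r : r != 0 -> exists f g, [/\ f != 0, g != 0 & r = f%:F / g%:F].
Proof.
move=> r0; have [f [g [g0 E]]] := fractionP r; exists f, g; split => //.
by apply: contraNneq r0 => f0; rewrite E f0 tofrac0 mul0r.
Qed.

Lemma ordM s r1 r2 : r1 != 0 -> r2 != 0 -> ord s (r1 * r2) = ord s r1 + ord s r2.
Proof.
move=> /ratfun1P[f1 [g1 [f10 g10 ->]]] /ratfun1P[f2 [g2 [f20 g20 ->]]].
rewrite mulf_div -!tofracM !pord_neq0 ?mulf_neq0 //.
have := pordM s f10 f20; have := pordM s g10 g20; ord_lia.
Qed.

Lemma ord_1 s : ord s (1 : ratfun1 K) = 0.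
Proof. by have := @ordM s 1 1; rewrite mulr1 oner_eq0 => /(_ isT isT); ord_lia. Qed.

Lemma ordV s r : ord s r^-1 = - ord s r.
Proof.
have [->|r0] := eqVneq r 0; first by rewrite invr0 ord_0.
by have := @ordM s r r^-1 r0; rewrite invr_eq0 r0 mulfV // ord_1 => /(_ isT); ord_lia.
Qed.

Lemma ordX s r n : ord s (r ^+ n) = n%:Z * ord s r.
Proof.
have [->|r0] := eqVneq r 0.
  by rewrite expr0n ord_0; case: n => [|n]; rewrite /= ?ord_1 ?ord_0 mulr0.
elim: n => [|n IH]; first by rewrite expr0 ord_1 mul0r.
by rewrite exprS ordM ?expf_neq0 // IH; ord_lia.
Qed.

Lemma ordN s r : ord s (- r) = ord s r.
Proof.
have [->|r0] := eqVneq r 0; first by rewrite oppr0.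
have N0 : (-1 : ratfun1 K) != 0 by rewrite oppr_eq0 oner_eq0.
rewrite (_ : - r = -1 * r); last by rewrite mulN1r.
rewrite (ordM s N0 r0).
by have := ordM s N0 N0; rewrite mulrNN mulr1 ord_1; ord_lia.
Qed.

Lemma ordD_ge s r1 r2 (k : int) : r1 + r2 != 0 ->
  (r1 != 0 -> k <= ord s r1) -> (r2 != 0 -> k <= ord s r2) ->
  k <= ord s (r1 + r2).
Proof.
have [->|n1] := eqVneq r1 0; first by rewrite add0r => H _; apply.
have [->|n2] := eqVneq r2 0; first by rewrite addr0 => H + _; apply.
move=> n12 /(_ isT) + /(_ isT).
have [f1 [g1 [f10 g10 E1]]] := ratfun1P n1.
have [f2 [g2 [f20 g20 E2]]] := ratfun1P n2.
have E : r1 + r2 = (f1 * g2 + f2 * g1)%:F / (g1 * g2)%:F.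
  by rewrite E1 E2 addf_div ?tofrac_eq0 // tofracM tofracD !tofracM.
have S0 : f1 * g2 + f2 * g1 != 0.
  by apply: contraNneq n12 => H; rewrite E H tofrac0 mul0r.
rewrite E E1 E2 !pord_neq0 ?mulf_neq0 // => k1 k2.
have := @pordD s (f1 * g2) (f2 * g1) (k + pord s (g1 * g2)) S0.
rewrite ?mulf_neq0 // => /(_ isT isT).
move: k1 k2 (pordM s f10 g20) (pordM s f20 g10) (pordM s g10 g20); ord_lia.
Qed.

Lemma ordD_lt s r1 r2 : r1 != 0 -> (r2 != 0 -> ord s r1 < ord s r2) ->
  r1 + r2 != 0 /\ ord s (r1 + r2) = ord s r1.
Proof.
move=> n1 lt12.
have [E|n2] := eqVneq r2 0; first by rewrite E addr0.
have {}lt12 := lt12 n2.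
have n12 : r1 + r2 != 0.
  by apply/eqP => /eqP; rewrite addr_eq0 => /eqP E; move: lt12; rewrite E ordN ltxx.
split=> //; apply/eqP; rewrite eq_le; apply/andP; split; last first.
  by apply: ordD_ge => // _; apply: ltW.
rewrite leNgt; apply/negP => lt.
(* If the sum had larger order than r1, then so would r1, being the difference of the sum and r2. *)
have E : (r1 + r2) + - r2 = r1 by rewrite addrK.
have := @ordD_ge s (r1 + r2) (- r2) (ord s r1 + 1).
rewrite E ordN => /(_ n1 (fun _ => ltac:(lia)) (fun _ => ltac:(lia))).
by rewrite gerDl.
Qed.

Lemma ord_const s (k : K) : ord s (const1 k) = 0.
Proof.
rewrite /const1; have [->|k0] := eqVneq k 0.
  by rewrite polyC0 tofrac0 ord_0.
have kP0 : k%:P != 0 by rewrite polyC_eq0.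
have := @pord_neq0 s k%:P 1 kP0; rewrite oner_eq0 tofrac1 divr1 => -> //.
case: s => [z|] /=; last by rewrite size_polyC k0 size_poly1 subrr.
by rewrite !mupNroot ?root1 // rootC.
Qed.

Lemma ord_tofrac s f : f != 0 -> ord s (f%:F) = pord s f - pord s 1.
Proof. by move=> f0; rewrite -pord_neq0 ?oner_eq0 // tofrac1 divr1. Qed.

Lemma ord_X_None : ord None ('X%:F : ratfun1 K) = - 1.
Proof. by rewrite ord_tofrac ?polyX_eq0 //= size_polyX size_poly1. Qed.

Lemma ord_X_Some z : ord (Some z) ('X%:F : ratfun1 K) = (z == 0)%:Z.
Proof.
rewrite ord_tofrac ?polyX_eq0 //= (mupNroot (root1 z)) subr0.
have [->|z0] := eqVneq; first by have := @mup_XsubCX K 1 0 0; rewrite eqxx expr1 subr0 => ->.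
by rewrite mupNroot // rootX.
Qed.

Lemma vanishes_neq0 s r : r != 0 -> vanishes_at s r -> 0 < ord s r.
Proof. by move=> + [E|//]; rewrite E eqxx. Qed.

Lemma vanishesD s r1 r2 : vanishes_at s r1 -> vanishes_at s r2 -> vanishes_at s (r1 + r2).
Proof.
move=> v1 v2; have [->|n12] := eqVneq (r1 + r2) 0; first by left.
right; suff : 1 <= ord s (r1 + r2) by ord_lia.
by apply: ordD_ge => // n; [have := vanishes_neq0 n v1 | have := vanishes_neq0 n v2]; ord_lia.
Qed.

Lemma vanishesN s r : vanishes_at s r -> vanishes_at s (- r).
Proof. by case=> [->|H]; [left; rewrite oppr0 | right; rewrite ordN]. Qed.

Lemma vanishesB s r1 r2 : vanishes_at s r1 -> vanishes_at s r2 -> vanishes_at s (r1 - r2).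
Proof. by move=> v1 v2; apply: vanishesD => //; apply: vanishesN. Qed.

Lemma vanishes_mulr s r1 r2 : vanishes_at s r1 -> 0 <= ord s r2 -> vanishes_at s (r1 * r2).
Proof.
move=> [->|v1] o2; first by left; rewrite mul0r.
have [->|n2] := eqVneq r2 0; first by left; rewrite mulr0.
have n1 : r1 != 0 by apply: contraTneq v1 => ->; rewrite ord_0 ltxx.
by right; rewrite (ordM s n1 n2); move: v1 o2; ord_lia.
Qed.

Lemma vanishes_const s k : vanishes_at s (const1 k) -> k = 0.
Proof.
case=> [/eqP|]; last by rewrite ord_const ltxx.
by rewrite /const1 tofrac_eq0 polyC_eq0 => /eqP.
Qed.

Lemma ord_ge0_of_value s r k : vanishes_at s (r - const1 k) -> 0 <= ord s r.
Proof.
move=> v; have [->|r0] := eqVneq r 0; first by rewrite ord_0.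
have E : r - const1 k + const1 k = r by rewrite subrK.
rewrite -E; apply: ordD_ge.
- by rewrite E.
- by move=> n; have := vanishes_neq0 n v; ord_lia.
- by rewrite ord_const.
Qed.

Lemma ord_poly_ge0 z f : 0 <= ord (Some z) (f%:F : ratfun1 K).
Proof.
have [->|f0] := eqVneq f 0; first by rewrite tofrac0 ord_0.
by rewrite ord_tofrac //= (mupNroot (root1 z)) subr0.
Qed.

Lemma ord_poly_None f : f != 0 -> ord None (f%:F : ratfun1 K) = 1 - (size f)%:Z.
Proof. by move=> f0; rewrite ord_tofrac //= size_poly1 opprK addrC. Qed.

Lemma vanishes_horner z f k : vanishes_at (Some z) (f%:F - const1 k) <-> k = f.[z].
Proof.
have v : vanishes_at (Some z) (f%:F - const1 f.[z]).
  rewrite /const1 -tofracB; have [->|n0] := eqVneq (f - f.[z]%:P) 0.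
    by left; rewrite tofrac0.
  right; rewrite ord_tofrac //= (mupNroot (root1 z)) subr0 ltz_nat -XsubC_dvd //.
  by rewrite dvdp_XsubCl /root hornerD hornerN hornerC subrr.
split=> [v'|->] //; have := vanishesB v v'.
have -> : f%:F - const1 f.[z] - (f%:F - const1 k) = const1 (k - f.[z]).
  by rewrite /const1 polyCB tofracB opprB addrC addrA subrK.
by move=> /vanishes_const/eqP; rewrite subr_eq0 => /eqP.
Qed.

End Valuation.

(** * Evaluation of polynomials in two variables *)

(** The formula of [eval2] with values in a commutative ring, so that evaluation at functions and
    substitution of polynomials ([sub2]) share one set of lemmas. *)
Definition ev2 (K : fieldType) (E : comNzRingType) (iota : K -> E) (u v : E)
  (f : {poly {poly K}}) : E := (map_poly (map_poly iota) f).[u%:P].[v].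

Definition const11 (K : fieldType) (k : K) : {poly {poly K}} := k%:P%:P.

Notation sub2 := (ev2 (@const11 _)).

Lemma eval2E (K E : fieldType) (iota : K -> E) f u v :
  eval2 iota f u v = ev2 iota u v f.
Proof. by []. Qed.

HB.instance Definition _ (K : fieldType) :=
  GRing.RMorphism.copy (@const11 K) (polyC \o polyC).
HB.instance Definition _ (K : fieldType) :=
  GRing.RMorphism.copy (@const1 K) (@FracField.tofrac {poly K} \o polyC).
HB.instance Definition _ (K : fieldType) :=
  GRing.RMorphism.copy (@const2 K) (@FracField.tofrac {poly {poly K}} \o (polyC \o polyC)).

HB.instance Definition _ (K : fieldType) (E : comNzRingType)
    (iota : {rmorphism K -> E}) (u v : E) :=
  GRing.RMorphism.copy (ev2 iota u v)
    (horner_eval v \o (horner_eval u%:P \o map_poly (map_poly iota))).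

Section Evaluation.
Variable K : fieldType.
Implicit Types (f g h : {poly {poly K}}).

Section Ring.
Variables (E : comNzRingType) (iota : {rmorphism K -> E}).
Implicit Types (u v : E).

Lemma ev2C u v k : ev2 iota u v k%:P%:P = iota k.
Proof. by rewrite /ev2 !map_polyC /= hornerC map_polyC hornerC. Qed.

Lemma ev2X u v : ev2 iota u v 'X = u.
Proof. by rewrite /ev2 map_polyX hornerX hornerC. Qed.

Lemma ev2_inner u v (f : {poly K}) : ev2 iota u v f%:P = (map_poly iota f).[v].
Proof. by rewrite /ev2 map_polyC /= hornerC. Qed.

Lemma ev2Y u v : ev2 iota u v 'Y = v.
Proof. by rewrite ev2_inner map_polyX hornerX. Qed.

Lemma ev2D u v f g : ev2 iota u v (f + g) = ev2 iota u v f + ev2 iota u v g.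
Proof. exact: rmorphD. Qed.

Lemma ev2_0 u v : ev2 iota u v 0 = 0.
Proof. exact: rmorph0. Qed.

Lemma ev2N u v f : ev2 iota u v (- f) = - ev2 iota u v f.
Proof. by apply/eqP; rewrite -addr_eq0 -ev2D addNr ev2_0. Qed.

Lemma ev2B u v f g : ev2 iota u v (f - g) = ev2 iota u v f - ev2 iota u v g.
Proof. by rewrite ev2D ev2N. Qed.

Lemma ev2M u v f g : ev2 iota u v (f * g) = ev2 iota u v f * ev2 iota u v g.
Proof. exact: rmorphM. Qed.

Lemma ev2_exp u v f n : ev2 iota u v (f ^+ n) = ev2 iota u v f ^+ n.
Proof. exact: rmorphXn. Qed.

Lemma ev2_1 u v : ev2 iota u v 1 = 1.
Proof. exact: rmorph1. Qed.

Lemma ev2Xn u v n : ev2 iota u v 'X^n = u ^+ n.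
Proof. by rewrite (ev2_exp u v 'X n) (ev2X u v). Qed.

Lemma ev2Yn u v n : ev2 iota u v ('Y ^+ n) = v ^+ n.
Proof. by rewrite (ev2_exp u v 'Y n) (ev2Y u v). Qed.

Lemma eq_ev2 (iota' : {rmorphism K -> E}) u v f :
  iota =1 iota' -> ev2 iota u v f = ev2 iota' u v f.
Proof.
by move=> ii'; rewrite /ev2; do 2!congr (_.[_]); do 2!apply: eq_map_poly => ?.
Qed.

Lemma ev2_sum u v f n : (size f <= n)%N ->
  ev2 iota u v f = \sum_(i < n) (map_poly iota f`_i).[v] * u ^+ i.
Proof.
move=> sf; rewrite /ev2 (@horner_coef_wide _ n _ u%:P); last first.
  by apply: leq_trans sf; exact: size_poly.
rewrite horner_sum; apply: eq_bigr => i _.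
by rewrite coef_map /= hornerM -polyC_exp hornerC.
Qed.

Lemma rmorph_ev2 (E' : comNzRingType) (phi : {rmorphism E -> E'}) u v f :
  phi (ev2 iota u v f) = ev2 (phi \o iota) (phi u) (phi v) f.
Proof.
rewrite /ev2 -!horner_map /= map_polyC -!map_poly_comp /=.
do 2!congr (_.[_]); apply: eq_map_poly => g /=.
by rewrite -map_poly_comp.
Qed.
End Ring.

Lemma ev2_origin f : ev2 idfun 0 0 f = f`_0`_0.
Proof.
rewrite /ev2 horner_coef0 polyC0 horner_coef0 coef_map /= coef_map /=.
by [].
Qed.

Lemma sub2_id f : sub2 'X 'Y f = f.
Proof.
elim/poly_ind: f => [|f c IH]; first by rewrite rmorph0.
rewrite rmorphD rmorphM /= ev2X IH ev2_inner; congr (_ + _).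
have -> : map_poly (@const11 K) c = map_poly polyC (map_poly polyC c).
  by rewrite -map_poly_comp.
rewrite horner_map /=; congr (_%:P).
exact: comp_polyXr.
Qed.

Lemma ev2_unique (E : comNzRingType) (phi : {rmorphism {poly {poly K}} -> E})
    (iota : {rmorphism K -> E}) f :
  phi \o @const11 K =1 iota -> phi f = ev2 iota (phi 'X) (phi 'Y) f.
Proof. by move=> H; rewrite -{1}(sub2_id f) rmorph_ev2; apply: eq_ev2. Qed.

Lemma ev2_sub2 (E : comNzRingType) (iota : {rmorphism K -> E}) u v f g h :
  ev2 iota u v (sub2 g h f) = ev2 iota (ev2 iota u v g) (ev2 iota u v h) f.
Proof.
rewrite (rmorph_ev2 (@const11 K) (ev2 iota u v) g h f).
by apply: eq_ev2 => k; exact: ev2C.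
Qed.

Lemma ev2_swapXY (E : comNzRingType) (iota : {rmorphism K -> E}) u v f :
  ev2 iota u v (swapXY f) = ev2 iota v u f.
Proof. by rewrite /ev2 -swapXY_map horner2_swapXY. Qed.

Lemma ev2_tofrac f : ev2 (@const2 K) (xL K) (yL K) f = f%:F.
Proof. by symmetry; exact: (@ev2_unique _ (@FracField.tofrac _)). Qed.

(** Polynomial identities can be checked at the generic point (x, y), inside the field L, where
    division by x and y is allowed. *)
Lemma sub2_inj_eq f g :
  ev2 (@const2 K) (xL K) (yL K) f = ev2 (@const2 K) (xL K) (yL K) g -> f = g.
Proof. by rewrite !ev2_tofrac => /eqP; rewrite tofrac_eq => /eqP. Qed.

End Evaluation.

(* Unification is hopeless once it starts unfolding polynomial evaluations. *)
Opaque ev2.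

(** * The ideal of a parametrized curve *)

Lemma poly2_ind (K : fieldType) (P : {poly {poly K}} -> Prop) :
  (forall k, P k%:P%:P) -> P 'X -> P 'Y ->
  (forall f g, P f -> P g -> P (f + g)) ->
  (forall f g, P f -> P g -> P (f * g)) ->
  forall f, P f.
Proof.
move=> PC PX PY PD PM; elim/poly_ind => [|f c IH]; first exact: (PC 0).
apply: (PD _ _ (PM _ _ IH PX)).
elim/poly_ind: c => [|c k IHc]; first exact: (PC 0).
by rewrite rmorphD rmorphM; apply: PD (PC k); apply: PM.
Qed.

Section Generators.
Variables (K : fieldType) (E : fieldType) (iota : {rmorphism K -> E}).
Implicit Types (f g h : {poly {poly K}}) (u v : E).

(** The kernel of evaluation at (u, v) is the ideal of the curve parametrized by u and v.
    [is_equation] asks for this at the restricted coordinates of a chart. *)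
Definition gen u v f := forall g, ev2 iota u v g = 0 <-> exists h, g = h * f.

Lemma gen_vanish u v f : gen u v f -> ev2 iota u v f = 0.
Proof. by move=> /(_ f)[_]; apply; exists 1; rewrite mul1r. Qed.

Lemma gen_intro u v f : ev2 iota u v f = 0 ->
  (forall g, ev2 iota u v g = 0 -> exists h, g = h * f) -> gen u v f.
Proof. by move=> f0 H g; split=> [/H//|[h ->]]; rewrite rmorphM /= f0 mulr0. Qed.

Lemma gen_swap u v f : gen u v f -> gen v u (swapXY f).
Proof.
move=> Gf; apply: gen_intro; first by rewrite ev2_swapXY (gen_vanish Gf).
move=> g; rewrite -ev2_swapXY => /Gf[h E1]; exists (swapXY h).
by rewrite -[g]swapXYK E1 rmorphM.
Qed.

(** The last two hypotheses make substitution of (a, b) surjective, so a polynomial vanishing at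
    (u', v') is the substitute of one vanishing at (u, v). *)
Lemma gen_auto u v f u' v' a b a' b' :
  gen u v f -> ev2 iota u' v' a = u -> ev2 iota u' v' b = v ->
  sub2 a b a' = 'X -> sub2 a b b' = 'Y -> gen u' v' (sub2 a b f).
Proof.
move=> Gf Ea Eb Ea' Eb'; apply: gen_intro; first by rewrite ev2_sub2 Ea Eb (gen_vanish Gf).
move=> g; have Eg : g = sub2 a b (sub2 a' b' g) by rewrite ev2_sub2 Ea' Eb' sub2_id.
rewrite {1}Eg ev2_sub2 Ea Eb => /Gf[h Eh].
by exists (sub2 a b h); rewrite {1}Eg Eh rmorphM.
Qed.

(** The prime ['X] does not divide f, so it divides the cofactor h and can be cancelled one power at
    a time. *)
Lemma cancel_polyX f g h n : f`_0 != 0 -> 'X^n * g = h * f -> exists h', g = h' * f.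
Proof.
move=> f0; elim: n h => [|n IH] h; first by rewrite expr0 mul1r; exists h.
elim/poly_ind: h => [|h c _] E1.
  exists 0; apply/eqP; move/eqP: E1.
  by rewrite !mul0r mulf_eq0 expf_eq0 polyX_eq0 andbF.
have /eqP := congr1 (fun p : {poly _} => p`_0) E1.
rewrite coefXnM /= coef0M coefD coefMX coefC /= add0r eq_sym mulf_eq0 (negPf f0) orbF.
move=> /eqP c0; apply: (IH h); move: E1; rewrite c0 addr0 exprS -mulrA.
rewrite [h * 'X]mulrC -mulrA; apply: mulfI; by rewrite polyX_eq0.
Qed.

(** The new second coordinate is v / u - k, and multiplying it by u gives v - k u, which comes from
    below. Hence every polynomial upstairs comes from below after multiplication by a power of u. *)
Lemma blowup_lift (k : K) g : exists n g', sub2 'X ('X * ('Y + const11 k)) g' = 'X^n * g.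
Proof.
set s := sub2 _ _.
have sX : s 'X = 'X by exact: ev2X.
have sY : s 'Y = 'X * ('Y + const11 k) by exact: ev2Y.
have sC c : s (const11 c) = const11 c by exact: ev2C.
have sD f1 f2 : s (f1 + f2) = s f1 + s f2 by exact: rmorphD.
have sM f1 f2 : s (f1 * f2) = s f1 * s f2 by exact: rmorphM.
have s1 : s 1 = 1 by exact: rmorph1.
have sXn n : s 'X^n = 'X^n.
  elim: n => [|n IH]; first by rewrite expr0 s1.
  by rewrite exprS sM sX IH.
clearbody s.
elim/poly2_ind: g => [c|||f g [n [f' Ef]] [m [g' Eg]]|f g [n [f' Ef]] [m [g' Eg]]].
- by exists 0%N, (const11 c); rewrite mul1r sC.
- by exists 0%N, 'X; rewrite mul1r sX.
- exists 1%N, ('Y + const11 (- k) * 'X).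
  rewrite (sD 'Y) (sM (const11 (- k)) 'X) sX sY (sC (- k)).
  rewrite (_ : const11 (- k) = - const11 k) ?expr1; last by rewrite /const11 !polyCN.
  by rewrite mulNr [const11 k * 'X]mulrC -mulrBr addrK.
- exists (n + m)%N, ('X^m * f' + 'X^n * g').
  rewrite (sD _ ('X^n * g')) (sM 'X^m f') (sM 'X^n g') !sXn Ef Eg exprD.
  by rewrite mulrDr !mulrA ['X^m * 'X^n]mulrC.
- exists (n + m)%N, (f' * g').
  by rewrite (sM f' g') Ef Eg exprD mulrACA.
Qed.

(** A polynomial vanishing upstairs is moved below by [blowup_lift], divided by f there and pulled
    back. The powers of ['X] introduced on the way cancel because the exceptional curve is not a
    component of f'. *)
Lemma gen_blowup u v f k m f' :
  gen u v f -> u != 0 ->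
  sub2 'X ('X * ('Y + const11 k)) f = 'X^m * f' -> f'`_0 != 0 ->
  gen u (v / u - iota k) f'.
Proof.
move=> Gf u0 Ef f'0; set v' := _ - _.
have evs g : ev2 iota u v' (sub2 'X ('X * ('Y + const11 k)) g) = ev2 iota u v g.
  rewrite ev2_sub2 ev2X rmorphM rmorphD /= ev2X ev2Y ev2C /v' subrK.
  by rewrite mulrCA divff ?mulr1.
apply: gen_intro.
  have /eqP := evs f; rewrite Ef (gen_vanish Gf) rmorphM rmorphXn /= ev2X.
  by rewrite mulf_eq0 expf_eq0 (negPf u0) andbF => /eqP.
move=> g g0; have [n [g' Eg]] := blowup_lift k g.
have /Gf[h Eh] : ev2 iota u v g' = 0.
  by rewrite -evs Eg rmorphM /= g0 mulr0.
apply: (@cancel_polyX f' g (sub2 'X ('X * ('Y + const11 k)) h * 'X^m) n f'0).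
by rewrite -Eg Eh rmorphM /= Ef mulrA.
Qed.

End Generators.

(** * Inversion of a coordinate, and monomial curves *)

Section Reversal.
Variables (K : fieldType).
Implicit Types (f g h : {poly {poly K}}).

(** This is U^n f(1 / U, V) for f of degree at most n in U. *)
Definition rev_poly n f : {poly {poly K}} := \poly_(i < n.+1) f`_(n - i).

Lemma ev2_rev (E : fieldType) (iota : {rmorphism K -> E}) (u v : E) n f :
  u != 0 -> (size f <= n.+1)%N ->
  ev2 iota u v (rev_poly n f) = u ^+ n * ev2 iota u^-1 v f.
Proof.
move=> u0 sf; rewrite !(@ev2_sum _ _ _ _ _ _ n.+1) ?size_poly // mulr_sumr.
rewrite (reindex_inj rev_ord_inj) /=.
apply: eq_bigr => i _.
have lei : (i <= n)%N by rewrite -ltnS.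
have -> : (rev_poly n f)`_(n.+1 - i.+1) = f`_i.
  by rewrite /rev_poly coef_poly subSS ltnS leq_subr subKn.
rewrite mulrCA subSS; congr (_ * _).
by rewrite exprVn -expfB_cond // (negPf u0).
Qed.

Lemma rev_polyK n f : (size f <= n.+1)%N -> rev_poly n (rev_poly n f) = f.
Proof.
move=> sf; apply/polyP => i; rewrite /rev_poly !coef_poly.
case: ltnP => i_n; last by rewrite nth_default // (leq_trans sf).
by rewrite ltnS leq_subr subKn.
Qed.

Lemma rev_polyM m n f g : (size f <= m.+1)%N -> (size g <= n.+1)%N ->
  rev_poly (m + n) (f * g) = rev_poly m f * rev_poly n g.
Proof.
move=> sf sg; apply: sub2_inj_eq.
have x0 : xL K != 0 by rewrite tofrac_eq0 polyX_eq0.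
rewrite rmorphM /= (ev2_rev _ _ x0 sf) (ev2_rev _ _ x0 sg) ev2_rev //; last first.
  by apply: leq_trans (size_polyMleq _ _) _; lia.
by rewrite rmorphM /= exprD; ring.
Qed.

Lemma gen_inv (E : fieldType) (iota : {rmorphism K -> E}) (u v : E) n f :
  gen iota u v f -> u != 0 -> size f = n.+1 -> gen iota u^-1 v (rev_poly n f).
Proof.
move=> Gf u0 sf.
have V0 : u^-1 != 0 by rewrite invr_eq0.
apply: gen_intro; first by rewrite ev2_rev ?sf // invrK (gen_vanish Gf) mulr0.
(* With this N the cofactor h has degree at most N - n = size g, so the reversal of h f in degree N
   splits into the reversals of h and of f. *)
move=> g g0; set N := (size g + n)%N.
have sg : (size g <= N.+1)%N by rewrite /N; lia.
have /Gf[h Eh] : ev2 iota u v (rev_poly N g) = 0 by rewrite ev2_rev // g0 mulr0.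
have f0 : f != 0 by rewrite -size_poly_gt0 sf.
have sh : (size h <= (size g).+1)%N.
  have [->|h0] := eqVneq h 0; first by rewrite size_poly0.
  have : (size (h * f)%R <= N.+1)%N by rewrite -Eh size_poly.
  by rewrite size_mul // sf /N; move: (size h) (size g) => i j; lia.
exists (rev_poly (size g) h).
by rewrite -rev_polyM ?sf // -Eh rev_polyK.
Qed.

Lemma coprime_modn_mul_inj a b i k : coprime a b -> (i < b)%N -> (k < b)%N ->
  (a * i = a * k %[mod b])%N -> i = k.
Proof.
move=> cab; wlog le_ki : i k / (k <= i)%N => [H|ib kb /eqP].
  by case: (leqP k i) => [/H//|/ltnW/H + ib kb E]; move=> /(_ kb ib (esym E)).
rewrite eqn_mod_dvd ?leq_mul2l ?le_ki ?orbT // -mulnBr Gauss_dvdr 1?coprime_sym //.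
have [|/dvdn_leq/[apply]] := posnP (i - k); lia.
Qed.

(** Division by the equation, monic of degree b in the first variable, leaves monomials u^i v^j with
    i < b. Their values t^(a i + b j) have distinct exponents, since a i modulo b determines i, so a
    remainder that vanishes at the transcendental t is 0. *)
Lemma gen_monomial (E : fieldType) (iota : {rmorphism K -> E}) (t : E) a b :
  (forall P : {poly K}, (map_poly iota P).[t] = 0 -> P = 0) ->
  (0 < a)%N -> (0 < b)%N -> coprime a b ->
  gen iota (t ^+ a) (t ^+ b) ('X^b - 'Y^+a).
Proof.
move=> tr a0 b0 cab.
have f_eq0 : ev2 iota (t ^+ a) (t ^+ b) ('X^b - 'Y ^+ a) = 0.
  by rewrite ev2B ev2Xn ev2Yn -!exprM mulnC subrr.
apply: gen_intro => // g g0.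
have Ef : 'X^b - 'Y ^+ a = 'X^b - ('X^a)%:P :> {poly {poly K}} by rewrite polyC_exp.
rewrite Ef in f_eq0 *; set f := _ - _ in f_eq0 *.
have fm : f \is monic by exact: monicXnsubC.
have Eg := Pdiv.RingMonic.rdivp_eq fm g.
set q := Pdiv.Ring.rdivp g f in Eg; set r := Pdiv.Ring.rmodp g f in Eg.
exists q; rewrite {1}Eg; suff -> : r = 0 by rewrite addr0.
have sr : (size r <= b)%N.
  have := Pdiv.Ring.ltn_rmodpN0 g (monic_neq0 fm).
  by rewrite size_XnsubC.
have r0 : ev2 iota (t ^+ a) (t ^+ b) r = 0.
  by move: g0; rewrite Eg ev2D ev2M f_eq0 mulr0 add0r.
(* The value of the remainder at (t^a, t^b), written as one polynomial in t. *)
pose P := \sum_(i < b) 'X^(a * i) * (r`_i \Po 'X^b).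
have P0 : P = 0.
  apply: tr; rewrite -r0 /P rmorph_sum /= horner_sum (ev2_sum _ _ _ sr).
  apply: eq_bigr => i _.
  rewrite rmorphM /= map_polyXn map_comp_poly map_polyXn hornerM horner_comp !hornerXn.
  by rewrite -exprM mulrC.
apply/polyP => i; rewrite coef0; case: (ltnP i b) => ib; last first.
  by rewrite nth_default // (leq_trans sr).
apply/polyP => j; rewrite coef0.
have := congr1 (fun p : {poly K} => p`_(a * i + b * j)) P0.
rewrite /= coef0 coef_sum (bigD1 (Ordinal ib)) //= big1 => [|k /eqP ki].
  rewrite addr0 coefXnM ltnNge leq_addr /= addKn coef_comp_poly_Xn //.
  by rewrite dvdn_mulr // mulKn.
rewrite coefXnM; case: ltnP => // le; rewrite coef_comp_poly_Xn //.
case: ifP => // /dvdnP[c Ec]; case: ki; apply: val_inj => /=.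
have : (a * k = a * i %[mod b])%N.
  have E2 : (a * i + b * j = a * k + c * b)%N by rewrite -Ec; lia.
  by rewrite -[RHS](modnMDl j) [(j * b)%N]mulnC addnC E2 addnC modnMDl.
exact: coprime_modn_mul_inj.
Qed.
End Reversal.

(** * Restriction to the curve and local equations *)

Section Restriction.
Variables (K : fieldType) (D : curve K).
Local Notation ev1 := (ev2 (@const1 K)).
Local Notation evL := (ev2 (@const2 K)).
Implicit Types (w : ratfun2 K) (r : ratfun1 K) (f g : {poly {poly K}}).

Lemma restrictsP w r : restricts D w r <->
  exists N M, [/\ M != 0, w = N%:F / M%:F, ev1 D.1 D.2 M != 0
                & r = ev1 D.1 D.2 N / ev1 D.1 D.2 M].
Proof.
rewrite /restricts; split=> -[N [M]].
  rewrite !eval2E => -[Ew M0 Er]; exists N, M; split => //.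
  apply: contraNneq M0 => ->; apply/eqP; exact: (ev2_0 (@const1 K)).
by case=> _ Ew M0 Er; exists N, M; rewrite !eval2E; split.
Qed.

(** The value is independent of the fraction N / M, so the choice made by [restrict] is
    determined. *)
Lemma restricts_unique w r r' : restricts D w r -> restricts D w r' -> r = r'.
Proof.
move=> /restrictsP[N [M [M0 -> eM ->]]] /restrictsP[N' [M' [M0' /eqP E eM' ->]]].
apply/eqP; rewrite (eqr_div _ _ eM eM') -(ev2M _ _ _ N M') -(ev2M _ _ _ N' M).
rewrite eqr_div ?tofrac_eq0 // -!tofracM tofrac_eq in E.
by rewrite (eqP E).
Qed.

Lemma restrictE w r : restricts D w r -> Defs.restrict D w = r.
Proof. by move=> R; apply: xget_unique => // r' /restricts_unique; apply. Qed.

Lemma restricts_poly f : restricts D f%:F (ev1 D.1 D.2 f).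
Proof.
apply/restrictsP; exists f, 1; split; rewrite ?oner_eq0 // ?tofrac1 ?divr1 //.
  by rewrite ev2_1 oner_eq0.
by rewrite ev2_1 divr1.
Qed.

Lemma restricts_const k : restricts D (const2 k) (const1 k).
Proof. by have := restricts_poly k%:P%:P; rewrite ev2C. Qed.

Lemma restricts_x : restricts D (xL K) D.1.
Proof. by have := restricts_poly 'X; rewrite ev2X. Qed.

Lemma restricts_y : restricts D (yL K) D.2.
Proof. by have := restricts_poly 'Y; rewrite ev2Y. Qed.

Lemma restrictsD w w' r r' : restricts D w r -> restricts D w' r' ->
  restricts D (w + w') (r + r').
Proof.
move=> /restrictsP[N [M [M0 -> eM ->]]] /restrictsP[N' [M' [M0' -> eM' ->]]].
apply/restrictsP; exists (N * M' + N' * M), (M * M'); split.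
- by rewrite mulf_neq0.
- by rewrite addf_div ?tofrac_eq0 // tofracD !tofracM.
- by rewrite ev2M; exact: mulf_neq0 eM eM'.
- rewrite (addf_div _ _ eM eM') (ev2D _ _ _ (N * M')) (ev2M _ _ _ N M').
  by rewrite (ev2M _ _ _ N' M) (ev2M _ _ _ M M').
Qed.

Lemma restrictsM w w' r r' : restricts D w r -> restricts D w' r' ->
  restricts D (w * w') (r * r').
Proof.
move=> /restrictsP[N [M [M0 -> eM ->]]] /restrictsP[N' [M' [M0' -> eM' ->]]].
apply/restrictsP; exists (N * N'), (M * M'); split.
- by rewrite mulf_neq0.
- by rewrite mulf_div !tofracM.
- by rewrite ev2M; exact: mulf_neq0 eM eM'.
- by rewrite mulf_div (ev2M _ _ _ N N') (ev2M _ _ _ M M').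
Qed.

Lemma restrictsN w r : restricts D w r -> restricts D (- w) (- r).
Proof.
move=> /restrictsP[N [M [M0 -> eM ->]]]; apply/restrictsP; exists (- N), M.
split=> //; first by rewrite tofracN mulNr.
by rewrite (ev2N _ _ _ N) mulNr.
Qed.

Lemma restrictsB w w' r r' : restricts D w r -> restricts D w' r' ->
  restricts D (w - w') (r - r').
Proof. by move=> R /restrictsN; apply: restrictsD. Qed.

Lemma restricts_neq0 w r : restricts D w r -> r != 0 -> w != 0.
Proof.
move=> R; apply: contra_neq => w0; rewrite w0 in R.
by have := restricts_poly 0; rewrite tofrac0 ev2_0 => /(restricts_unique R).
Qed.

Lemma restrictsV w r : restricts D w r -> r != 0 -> restricts D w^-1 r^-1.
Proof.
move=> R r0; have := restricts_neq0 R r0.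
case/restrictsP: R r0 => [N [M [M0 -> eM ->]]] r0 w0.
apply/restrictsP; exists M, N; split.
- by apply: contra_neq w0 => ->; rewrite tofrac0 mul0r.
- by rewrite invf_div.
- by apply: contra_neq r0 => ->; rewrite mul0r.
- by rewrite invf_div.
Qed.

Lemma restricts_div w w' r r' : restricts D w r -> restricts D w' r' -> r' != 0 ->
  restricts D (w / w') (r / r').
Proof. by move=> R R' r0; apply: restrictsM => //; apply: restrictsV. Qed.

Lemma restrictsX w r n : restricts D w r -> restricts D (w ^+ n) (r ^+ n).
Proof.
move=> R; elim: n => [|n IH]; last by rewrite !exprS; apply: restrictsM.
by rewrite !expr0; have := restricts_poly 1; rewrite tofrac1 ev2_1.
Qed.

Lemma restricts_ev2 u v ru rv f : restricts D u ru -> restricts D v rv ->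
  restricts D (evL u v f) (ev1 ru rv f).
Proof.
move=> Ru Rv; elim/poly2_ind: f => [k|||f g If Ig|f g If Ig].
- by rewrite !ev2C; exact: restricts_const.
- by rewrite (ev2X _ u v) (ev2X _ ru rv).
- by rewrite (ev2Y _ u v) (ev2Y _ ru rv).
- by rewrite !ev2D; exact: restrictsD.
- by rewrite !ev2M; exact: restrictsM.
Qed.

(** For nonzero g the cofactors are units, and the units of K[U, V] are the nonzero constants. *)
Lemma mutual_dvd_scalar f g h h' : f = h * g -> g = h' * f ->
  exists2 k : K, k != 0 & f = const11 k * g.
Proof.
have [->|g0] := eqVneq g 0.
  by move=> -> _; exists 1; rewrite ?oner_eq0 // !mulr0.
move=> Ef Eg; suff [k k0 Eh] : exists2 k : K, k != 0 & h = const11 k by exists k; rewrite -?Eh.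
have : h \is a GRing.unit.
  apply/unitrPr; exists h'; apply: (mulIf g0).
  by rewrite mul1r [h * h']mulrC -mulrA -Ef.
rewrite poly_unitE => /andP[/eqP sh]; have Eh := size1_polyC (eq_leq sh).
set c := h`_0 in Eh *.
rewrite poly_unitE => /andP[/eqP sc]; have Ec := size1_polyC (eq_leq sc).
rewrite unitfE => c0.
by exists c`_0 => //; rewrite Eh {1}Ec.
Qed.

(** [equation] is a choice among generators. Any explicitly known generator agrees with it up to a
    nonzero constant, which affects neither orders nor smoothness. *)
Lemma equation_scalar c ru rv f : restricts D c.1 ru -> restricts D c.2 rv ->
  gen (@const1 K) ru rv f ->
  exists2 k : K, k != 0 & equation D c = const11 k * f.
Proof.
move=> Ru Rv Gf.
have [ru' [rv' [Ru' Rv' G']]] : is_equation D c (equation D c).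
  by apply: xgetPex; exists f, ru, rv; split.
have Eu := restricts_unique Ru Ru'; have Ev := restricts_unique Rv Rv'; subst ru' rv'.
have [h Eh] : exists h, equation D c = h * f by apply/Gf/G'; exists 1; rewrite mul1r.
have [h' Eh'] : exists h', f = h' * equation D c by apply/G'/Gf; exists 1; rewrite mul1r.
exact: mutual_dvd_scalar Eh Eh'.
Qed.

(* [n] is the order at [s] of the quotient of the local equation [f] by the
   equation in the base chart. *)
Definition local_eq (s : P1 K) (c : chart K) ru rv f (n : int) :=
  [/\ restricts D c.1 ru, restricts D c.2 rv, gen (@const1 K) ru rv f
    & exists w rw, [/\ evL c.1 c.2 f = w * equation_in_L D (base_chart K),
        restricts D w rw, rw != 0 & ord s rw = n]].

Lemma local_eq_swap s c ru rv f n : local_eq s c ru rv f n ->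
  local_eq s (c.2, c.1) rv ru (swapXY f) n.
Proof.
by case=> Ru Rv G H; split=> //=; [exact: gen_swap | rewrite ev2_swapXY].
Qed.

(** As a function, f' is f divided by u^m, which costs m times the order of u. *)
Lemma local_eq_blowup s c ru rv f n k m f' : local_eq s c ru rv f n -> ru != 0 ->
  sub2 'X ('X * ('Y + const11 k)) f = 'X^m * f' -> f'`_0 != 0 ->
  local_eq s (c.1, c.2 / c.1 - const2 k) ru (rv / ru - const1 k) f' (n - m%:Z * ord s ru).
Proof.
case: c => u v [/= Ru Rv G [w [rw [Ew Rw rw0 <-]]]] ru0 Ef f'0.
have u0 := restricts_neq0 Ru ru0.
split=> //=.
- by apply: restrictsB (restricts_const k); exact: restricts_div.
- exact: gen_blowup G ru0 Ef f'0.
have rum0 : ru ^+ m != 0 by rewrite expf_neq0.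
have rumV0 : (ru ^+ m)^-1 != 0 by rewrite invr_eq0.
exists (w / u ^+ m), (rw / ru ^+ m); split.
- rewrite mulrAC -Ew; apply: (canRL (mulfK _)); first by rewrite expf_neq0.
  set v' := v / u - const2 k.
  have <- : evL u v' ('X^m * f') = evL u v' f' * u ^+ m by rewrite ev2M ev2Xn mulrC.
  rewrite -Ef ev2_sub2 (ev2X (@const2 K) u v') ev2M (ev2X (@const2 K) u v') ev2D.
  rewrite (ev2Y (@const2 K) u v') ev2C /v' subrK.
  by rewrite mulrCA divff ?mulr1.
- exact: restricts_div Rw (restrictsX m Ru) rum0.
- exact: mulf_neq0 rw0 rumV0.
- by rewrite (ordM s rw0 rumV0) ordV ordX.
Qed.

(** The summand of [self_intersection] at s. *)
Definition local_degree (X : surface K) (s : P1 K) : int :=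
  ord s (Defs.restrict D (equation_in_L D (point_at X D s) / equation_in_L D (base_chart K))).

Lemma local_degree_eq X s c ru rv f n : equation_in_L D (base_chart K) != 0 ->
  point_at X D s = c -> local_eq s c ru rv f n -> local_degree X s = n.
Proof.
move=> F0 Ec [Ru Rv G [w [rw [Ew Rw rw0 <-]]]].
have [k k0 Ek] := equation_scalar Ru Rv G.
have kc0 : const1 k != 0 by rewrite /const1 tofrac_eq0 polyC_eq0.
rewrite /local_degree Ec (@restrictE _ (const1 k * rw)).
  by rewrite (ordM s kc0 rw0) ord_const add0r.
rewrite {1}/equation_in_L Ek.
have -> : eval2 (@const2 K) (const11 k * f) c.1 c.2 =
    const2 k * (w * equation_in_L D (base_chart K)).
  by rewrite -Ew -(ev2C (@const2 K) c.1 c.2 k) -ev2M.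
rewrite mulrA mulfK //; apply: restrictsM => //; exact: restricts_const.
Qed.

Lemma smooth_atE X s c ru rv f n : point_at X D s = c -> local_eq s c ru rv f n ->
  smooth_at X D s <-> (f`_1`_0 != 0 \/ f`_0`_1 != 0).
Proof.
move=> Ec [Ru Rv G _]; have [k k0 Ek] := equation_scalar Ru Rv G.
have E i j : (const11 k * f)`_i`_j = k * f`_i`_j by rewrite /const11 !coefCM.
by rewrite /smooth_at Ec Ek !E !mulf_eq0 !(negPf k0).
Qed.

End Restriction.

(** * Blowing up *)

Section Surfaces.
Variables (K : fieldType) (D : curve K).
Implicit Types (X : surface K) (c d : chart K) (s : P1 K).

(** Each parameter has exactly one image among the pairs of X, so [point_at] never falls back on its
    default. The condition concerns points on D only; [blowup_point] shows that the blow-ups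
    preserve it. *)
Definition one_point X := forall s, exists c, forall d,
  (X d /\ passes_through D s d) <-> d = c.

Lemma point_atP X s d : one_point X ->
  (X d /\ passes_through D s d) <-> d = point_at X D s.
Proof.
move=> /(_ s)[c Hc]; suff -> : point_at X D s = c by exact: Hc.
by apply: xget_unique => [|d' /Hc//]; exact/Hc.
Qed.

Lemma passes_throughE s c ru rv : restricts D c.1 ru -> restricts D c.2 rv ->
  passes_through D s c <-> vanishes_at s ru /\ vanishes_at s rv.
Proof.
move=> Ru Rv; split=> [[ru' [rv' [Ru' Rv' v1 v2]]]|[v1 v2]]; last by exists ru, rv; split.
by rewrite (restricts_unique Ru Ru') (restricts_unique Rv Rv').
Qed.

Definition exceptional c d :=
  (exists k, d = (c.1, c.2 / c.1 - const2 k)) \/ d = (c.1 / c.2, c.2).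

Lemma blowupE X c d : blowup X c d <-> (X d /\ d <> c) \/ exceptional c d.
Proof.
split; first by case=> [[|]|]; [left | right; left | right; right].
by case=> [|[|]]; [left; left | left; right | right].
Qed.

Section Center.
Variables (c : chart K) (ru rv : ratfun1 K).
Hypotheses (Ru : restricts D c.1 ru) (Rv : restricts D c.2 rv).
Hypotheses (ru0 : ru != 0) (rv0 : rv != 0).

Lemma passes_slope s k : passes_through D s (c.1, c.2 / c.1 - const2 k) <->
  vanishes_at s ru /\ vanishes_at s (rv / ru - const1 k).
Proof.
apply: passes_throughE => //=.
exact: restrictsB (restricts_div Rv Ru ru0) (restricts_const D k).
Qed.

Lemma passes_vertical s : passes_through D s (c.1 / c.2, c.2) <->
  vanishes_at s (ru / rv) /\ vanishes_at s rv.
Proof. by apply: passes_throughE => //=; exact: restricts_div Ru Rv rv0. Qed.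

(** An exceptional point lies over c: v is (v / u) u with v / u regular at s, or symmetrically u is
    (u / v) v. *)
Lemma exceptional_passes s d : exceptional c d -> passes_through D s d ->
  passes_through D s c.
Proof.
move=> ex pd; apply/(passes_throughE s Ru Rv).
case: ex pd => [[k ->]|->] /=.
  move=> /passes_slope[v1 v2]; split => //.
  by rewrite -(divfK ru0 rv) mulrC; apply: vanishes_mulr v1 (ord_ge0_of_value v2).
move=> /passes_vertical[v1 v2]; split => //.
rewrite -(divfK rv0 ru); apply: vanishes_mulr v1 _.
by have := vanishes_neq0 rv0 v2; ord_lia.
Qed.

(** The exceptional points are the possible values of v / u in P^1, and a function has only one
    value at s. *)
Lemma exceptional_unique s d d' : exceptional c d -> exceptional c d' ->
  passes_through D s d -> passes_through D s d' -> d = d'.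
Proof.
have q0 : rv / ru != 0 by exact: divf_neq0 rv0 ru0.
have excl k : vanishes_at s (rv / ru - const1 k) -> vanishes_at s (ru / rv) -> False.
  move=> /ord_ge0_of_value + v; rewrite -invf_div in v.
  have iq0 : (rv / ru)^-1 != 0 by rewrite invr_eq0.
  by have := vanishes_neq0 iq0 v; rewrite ordV; ord_lia.
case=> [[k ->]|->] [[k' ->]|->] //=.
- move=> /passes_slope[_ v] /passes_slope[_ v'].
  have := vanishesB v v'; have -> : rv / ru - const1 k - (rv / ru - const1 k') = const1 (k' - k).
    by rewrite [const1 (k' - k)]rmorphB opprB addrC addrA subrK.
  by move=> /vanishes_const/eqP; rewrite subr_eq0 => /eqP ->.
- by move=> /passes_slope[_ v] /passes_vertical[v' _]; case: (excl _ v v').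
- by move=> /passes_vertical[v' _] /passes_slope[_ v]; case: (excl _ v v').
Qed.
End Center.

(** No other parameter passes through the point of s; otherwise blowing it up would move the images
    of those parameters too. *)
Definition isolated X s := forall s', s' <> s -> point_at X D s' <> point_at X D s.

Lemma blowup_point X s c c' ru rv :
  one_point X -> isolated X s -> point_at X D s = c ->
  restricts D c.1 ru -> restricts D c.2 rv -> ru != 0 -> rv != 0 ->
  exceptional c c' -> passes_through D s c' ->
  [/\ one_point (blowup X c), isolated (blowup X c) s, point_at (blowup X c) D s = c'
    & forall s', s' <> s -> point_at (blowup X c) D s' = point_at X D s'].
Proof.
move=> X1 iX Ec Ru Rv ru0 rv0 exc' pc'.
have at_s d : (blowup X c d /\ passes_through D s d) <-> d = c'.
  split=> [[/blowupE[[Xd dc]|exd] pd]|->]; last by split=> //; apply/blowupE; right.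
    by case: dc; rewrite -Ec; apply/(point_atP s d X1).
  exact: (exceptional_unique Ru Rv ru0 rv0 exd exc' pd pc').
have off_s s' d : s' <> s ->
    (blowup X c d /\ passes_through D s' d) <-> d = point_at X D s'.
  move=> s's; have cs' : point_at X D s' <> c by rewrite -Ec; exact: iX.
  have nc : ~ passes_through D s' c.
    move=> pc; apply: cs'; symmetry; apply/(point_atP s' c X1); split=> //.
    by have /(point_atP s c X1)[] := esym Ec.
  split=> [[/blowupE[[Xd dc]|exd] pd]|->].
  - exact/(point_atP s' d X1).
  - by case: nc; exact: (exceptional_passes Ru Rv ru0 rv0 exd pd).
  - have /(point_atP s' _ X1)[Xd pd] := erefl (point_at X D s').
    by split=> //; apply/blowupE; left.
have X1' : one_point (blowup X c).
  move=> s'; have [->|/eqP s's] := eqVneq s' s; first by exists c'.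
  by exists (point_at X D s') => d; exact: off_s.
have pt_s : point_at (blowup X c) D s = c'.
  by symmetry; apply/(point_atP s c' X1')/at_s.
have pt_off s' : s' <> s -> point_at (blowup X c) D s' = point_at X D s'.
  by move=> s's; symmetry; apply/(point_atP s' _ X1')/(off_s s' _ s's).
split=> // s' s's E; rewrite pt_off // pt_s in E.
have /(point_atP s' _ X1)[_ ps'] := erefl (point_at X D s').
rewrite E in ps'.
have pc := exceptional_passes Ru Rv ru0 rv0 exc' ps'.
apply: (iX s' s's); symmetry; apply/(point_atP s' _ X1); rewrite Ec; split=> //.
by have /(point_atP s c X1)[] := esym Ec.
Qed.

(** n is the contribution of s to D . D after the minimal resolution. The minimality clause
    determines [resolution_length]; the clause on the other parameters lets their contributions be
    read off on X. *)
Definition resolvable X s (n : int) := exists N,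
  [/\ smooth_at (blowups X D s N) D s,
      forall k, (k < N)%N -> ~ smooth_at (blowups X D s k) D s,
      forall s', s' <> s -> point_at (blowups X D s N) D s' = point_at X D s'
    & local_degree D (blowups X D s N) s = n].

Lemma resolvable_smooth X s n : smooth_at X D s -> local_degree D X s = n ->
  resolvable X s n.
Proof. by move=> sm dn; exists 0%N; split. Qed.

Lemma resolvable_blowup X s n : ~ smooth_at X D s ->
  let X' := blowup X (point_at X D s) in
  (forall s', s' <> s -> point_at X' D s' = point_at X D s') ->
  resolvable X' s n -> resolvable X s n.
Proof.
move=> nsm X' off [N [sm nsm' off' dn]].
have E k : blowups X D s k.+1 = blowups X' D s k by rewrite /blowups iterSr.
exists N.+1; rewrite !E; split=> //.
  by case=> [_|k kN]; [exact: nsm | rewrite E; exact: nsm'].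
by move=> s' s's; rewrite off' // off.
Qed.

Lemma resolveP X s n : resolvable X s n ->
  [/\ smooth_at (resolve X D s) D s,
      forall s', s' <> s -> point_at (resolve X D s) D s' = point_at X D s'
    & local_degree D (resolve X D s) s = n].
Proof.
case=> N [sm nsm off dn]; rewrite /resolve.
suff -> : resolution_length X D s = N by split.
apply: xget_unique => [|M [smM nsmM]]; first by split.
by case: (ltngtP M N) => // lt; [case: (nsm _ lt) | case: (nsmM _ lt)].
Qed.

End Surfaces.

(** * Germs whose Newton polygon is an edge *)

Section NewtonEdge.
Variable K : fieldType.
Implicit Types (f g h : {poly {poly K}}).

Lemma sub2_origin (a b g : {poly {poly K}}) :
  a`_0`_0 = 0 -> b`_0`_0 = 0 -> (sub2 a b g)`_0`_0 = g`_0`_0.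
Proof.
move=> a0 b0; pose i := [the {rmorphism K -> K} of idfun].
have E f : f`_0`_0 = ev2 i 0 0 f by rewrite ev2_origin.
by rewrite (E (sub2 a b g)) ev2_sub2 -(E a) -(E b) a0 b0 -E.
Qed.

(* The Newton polygon of [f] is the segment from U^B to V^A; such germs are
   stable under blowing up as long as A <> B. *)
Definition newton_edge (A B : nat) f :=
  [/\ f`_0`_A != 0, f`_B`_0 != 0
    & forall i j, (i * A + j * B < A * B)%N -> f`_i`_j = 0].

Lemma newton_edge_smooth A B f : (0 < A)%N -> (0 < B)%N -> newton_edge A B f ->
  (f`_1`_0 != 0 \/ f`_0`_1 != 0) <-> (A = 1%N \/ B = 1%N).
Proof.
move=> A0 B0 [fA fB f0]; split=> [H|[E|E]]; last 2 first.
- by right; rewrite E in fA.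
- by left; rewrite E in fB.
have [A1|A1] := leqP A 1; first by left; lia.
have [B1|B1] := leqP B 1; first by right; lia.
by case: H; rewrite f0 ?eqxx //; nia.
Qed.

Lemma newton_edge_swap A B f : newton_edge A B f -> newton_edge B A (swapXY f).
Proof.
move=> [fA fB f0]; split=> [||i j H]; rewrite coef_swapXY //.
by apply: f0; rewrite addnC [(A * B)%N]mulnC.
Qed.

Lemma coef_YnM n g i j :
  ('Y ^+ n * g)`_i`_j = if (j < n)%N then 0 else g`_i`_(j - n).
Proof. by rewrite -polyC_exp coefCM coefXnM. Qed.

Lemma coef_XnM n g i j :
  ('X^n * g)`_i`_j = if (i < n)%N then 0 else g`_(i - n)`_j.
Proof. by rewrite coefXnM; case: ifP; rewrite ?coef0. Qed.

Lemma newton_edge_binomial A B g h : (0 < A)%N -> (0 < B)%N ->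
  g`_0`_0 != 0 -> h`_0`_0 != 0 -> newton_edge A B ('Y ^+ A * g + 'X^B * h).
Proof.
have E i j : ('Y ^+ A * g + 'X^B * h)`_i`_j =
    (if (j < A)%N then 0 else g`_i`_(j - A)) + (if (i < B)%N then 0 else h`_(i - B)`_j).
  by rewrite !coefD coef_YnM coef_XnM.
move=> A0 B0 g0 h0; split=> [||i j H].
- by rewrite E ltnn subnn B0 addr0.
- by rewrite E ltnn subnn A0 add0r.
have iB : (i < B)%N by rewrite -(ltn_pmul2r A0) [(B * A)%N]mulnC; lia.
have jA : (j < A)%N by rewrite -(ltn_pmul2r B0); lia.
by rewrite E iB jA addr0.
Qed.

(** The substitution sends U^i V^j to U^(i + j) V^j. *)
Lemma coef_blowup f i j : (sub2 'X ('X * 'Y) f)`_i`_j =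
  if (j <= i)%N then f`_(i - j)`_j else 0.
Proof.
have sX : sub2 'X ('X * 'Y) ('X : {poly {poly K}}) = 'X by exact: ev2X.
have sY : sub2 'X ('X * 'Y) ('Y : {poly {poly K}}) = 'X * 'Y by exact: ev2Y.
have inner (c : {poly K}) i' j' : (sub2 'X ('X * 'Y) c%:P)`_i'`_j' = if j' == i' then c`_j' else 0.
  elim/poly_ind: c i' j' => [|c k IH] i' j'.
    by rewrite polyC0 ev2_0 !coef0 if_same.
  have -> : sub2 'X ('X * 'Y) (c * 'X + k%:P)%:P =
      'X^1 * ('Y ^+ 1 * sub2 'X ('X * 'Y) c%:P) + const11 k.
    by rewrite polyCD polyCM ev2D ev2M sY ev2C !expr1 mulrC mulrA.
  rewrite !coefD coef_XnM coef_YnM IH /const11 !coefC coefMX.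
  case: i' j' => [|i'] [|j']; rewrite ?coefC ?coef0 //= ?add0r ?addr0 ?subSS ?subn0 //.
elim/poly_ind: f i j => [|f c IH] i j.
  by rewrite ev2_0 !coef0 if_same.
have -> : sub2 'X ('X * 'Y) (f * 'X + c%:P) = 'X^1 * sub2 'X ('X * 'Y) f + sub2 'X ('X * 'Y) c%:P.
  by rewrite ev2D ev2M sX expr1 mulrC.
rewrite coefD coefD coef_XnM inner IH.
case: (ltngtP j i) => [ji|ij|->].
- have [d Ed] : exists d, i = (j + d).+1 by exists (i - j).-1; lia.
  have E1 : (i - j = d.+1)%N by lia.
  have E2 : (i - 1 = j + d)%N by lia.
  rewrite E1 E2 leq_addr addKn coefD coefMX coefC /= addr0 addr0.
  by rewrite Ed ltnS ltn0.
- by rewrite addr0; case: ifP => // _; case: leqP => //; lia.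
rewrite subnn coefD coefMX coefC /= add0r.
by case: ifP => [_|i0]; [rewrite add0r | case: leqP; rewrite ?add0r //; lia].
Qed.

(** After division by U^A the monomial U^i V^j has become U^(i + j - A) V^j: the end V^A of the edge
    is fixed and the end U^(A + B) moves to U^B. The surviving V^A shows that the exceptional curve
    is not a component of f'. *)
Lemma newton_edge_blowup A B f : (0 < A)%N -> (0 < B)%N -> newton_edge A (A + B) f ->
  exists f', [/\ sub2 'X ('X * ('Y + const11 0)) f = 'X^A * f', f'`_0 != 0
               & newton_edge A B f'].
Proof.
move=> A0 B0 [fA fB f0]; rewrite (_ : const11 0 = 0) ?addr0; last by rewrite /const11 polyC0.
set s := sub2 _ _ f.
have [f' Ef] : exists f', s = 'X^A * f'.
  exists (drop_poly A s); rewrite -{1}(poly_take_drop A s) mulrC.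
  suff -> : take_poly A s = 0 by rewrite add0r.
  apply/polyP => i; rewrite coef_take_poly coef0; case: ltnP => // iA.
  apply/polyP => j; rewrite coef0 coef_blowup; case: leqP => // ji; apply: f0.
  by nia.
have Ef' i j : f'`_i`_j = if (j <= i + A)%N then f`_(i + A - j)`_j else 0.
  by rewrite -coef_blowup -/s Ef coef_XnM ltnNge leq_addl addnK.
have f'A : f'`_0`_A != 0 by rewrite Ef' leqnn subnn.
exists f'; split=> //; first by apply: contra_neq f'A => ->; rewrite coef0.
split=> // [|i j H]; first by rewrite Ef' /= subn0 addnC.
rewrite Ef'; case: leqP => // ji; apply: f0.
by nia.
Qed.

End NewtonEdge.

(* Subtractive Euclidean algorithm on the exponents of a branch: [r] is the
   number of infinitely near points of multiplicity one that a normal crossing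
   resolution would blow up after the minimal one. *)
Inductive euclid_tail : nat -> nat -> nat -> Prop :=
| euclid_tail1l r : euclid_tail 1 r r
| euclid_tail1r r : euclid_tail r 1 r
| euclid_tail_addl A B r : (1 < A)%N -> (0 < B)%N -> euclid_tail A B r ->
    euclid_tail A (A + B) r
| euclid_tail_addr A B r : (0 < A)%N -> (1 < B)%N -> euclid_tail A B r ->
    euclid_tail (A + B) B r.

(** * Resolution of germs with one Newton edge *)

Section Resolution.
Variables (K : fieldType) (D : curve K) (s : P1 K).
Implicit Types (X : surface K) (c : chart K).

Definition germ c (A B : nat) (n : int) := exists ru rv f,
  [/\ local_eq D s c ru rv f n, ru != 0 /\ rv != 0, ord s ru = A%:Z, ord s rv = B%:Z
    & newton_edge A B f].

Lemma germ_swap c A B n : germ c A B n -> germ (c.2, c.1) B A n.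
Proof.
move=> [ru [rv [f [Lf [ru0 rv0] oru orv bf]]]]; exists rv, ru, (swapXY f).
by split=> //; [exact: local_eq_swap | exact: newton_edge_swap].
Qed.

Lemma germ_passes c A B n : (0 < A)%N -> (0 < B)%N -> germ c A B n ->
  passes_through D s c.
Proof.
move=> A0 B0 [ru [rv [f [[Ru Rv _ _] [ru0 rv0] oru orv bf]]]].
by apply/(passes_throughE s Ru Rv); split; right; rewrite ?oru ?orv.
Qed.

Lemma germ_blowupl c A B n : (0 < A)%N -> (0 < B)%N -> germ c A (A + B) n ->
  germ (c.1, c.2 / c.1 - const2 0) A B (n - (A * A)%:Z).
Proof.
move=> A0 B0 [ru [rv [f [Lf [ru0 rv0] oru orv bf]]]].
have [f' [Ef f'0 bf']] := newton_edge_blowup A0 B0 bf.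
have E : rv / ru - const1 0 = rv / ru by rewrite /const1 polyC0 tofrac0 subr0.
have En : n - A%:Z * ord s ru = n - (A * A)%:Z by rewrite oru PoszM.
have := local_eq_blowup Lf ru0 Ef f'0; rewrite {}E {}En => Lf'.
have iu0 := invr_neq0 ru0.
exists ru, (rv / ru), f'; split; [exact: Lf' | | exact: oru | | exact: bf'].
  by split; [exact: ru0 | exact: divf_neq0 rv0 ru0].
by rewrite (ordM s rv0 iu0) ordV oru orv; lia.
Qed.

Lemma germ_blowupr c A B n : (0 < A)%N -> (0 < B)%N -> germ c (A + B) B n ->
  germ (c.1 / c.2, c.2) A B (n - (B * B)%:Z).
Proof.
move=> A0 B0 /germ_swap; rewrite addnC => /(germ_blowupl B0 A0)/germ_swap /=.
by rewrite /const2 polyC0 tofrac0 subr0.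
Qed.

Hypothesis base0 : equation_in_L D (base_chart K) != 0.

Lemma germ_smooth X c A B n : (0 < A)%N -> (0 < B)%N ->
  point_at X D s = c -> germ c A B n ->
  smooth_at X D s <-> (A = 1%N \/ B = 1%N).
Proof.
move=> A0 B0 Ec [ru [rv [f [Lf _ _ _ bf]]]].
exact: iff_trans (smooth_atE Ec Lf) (newton_edge_smooth A0 B0 bf).
Qed.

Lemma germ_degree X c A B n : point_at X D s = c -> germ c A B n ->
  local_degree D X s = n.
Proof. by move=> Ec [ru [rv [f [Lf _ _ _ _]]]]; exact: local_degree_eq Ec Lf. Qed.

(** Each Euclidean step cuts a square, of side the multiplicity, off an A by B rectangle. The strip
    1 by r left at the end belongs to a smooth branch and is not cut, hence the correction r. *)
Lemma germ_resolvable A B r : euclid_tail A B r -> (0 < A)%N -> (0 < B)%N ->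
  forall X c n, one_point D X -> isolated D X s -> point_at X D s = c ->
  germ c A B n -> resolvable D X s (n - (A * B)%:Z + r%:Z).
Proof.
elim=> {A B r} [r|r|A B r A1 B00 _ IH|A B r A00 B1 _ IH] A0 B0 X c n X1 iX Ec gc.
- rewrite mul1n subrK; apply: resolvable_smooth; last exact: germ_degree gc.
  by apply/(germ_smooth A0 B0 Ec gc); left.
- rewrite muln1 subrK; apply: resolvable_smooth; last exact: germ_degree gc.
  by apply/(germ_smooth A0 B0 Ec gc); right.
- have nsm : ~ smooth_at X D s by move/(germ_smooth A0 B0 Ec gc); lia.
  have gc' := germ_blowupl A0 B00 gc.
  have [ru [rv [f [[Ru Rv _ _] [ru0 rv0] _ _ _]]]] := gc.
  have [] := blowup_point X1 iX Ec Ru Rv ru0 rv0 _ (germ_passes A0 B00 gc').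
    by left; exists 0.
  move=> X1' iX' Ec' off; apply: resolvable_blowup nsm _ _; rewrite Ec //.
  have := IH A0 B00 _ _ _ X1' iX' Ec' gc'.
  by congr (resolvable _ _ _ _); lia.
- have nsm : ~ smooth_at X D s by move/(germ_smooth A0 B0 Ec gc); lia.
  have gc' := germ_blowupr A00 B0 gc.
  have [ru [rv [f [[Ru Rv _ _] [ru0 rv0] _ _ _]]]] := gc.
  have [] := blowup_point X1 iX Ec Ru Rv ru0 rv0 _ (germ_passes A00 B0 gc').
    by right.
  move=> X1' iX' Ec' off; apply: resolvable_blowup nsm _ _; rewrite Ec //.
  have := IH A00 B0 _ _ _ X1' iX' Ec' gc'.
  by congr (resolvable _ _ _ _); lia.
Qed.
End Resolution.

(** * Tangency at infinity *)

Lemma tangent_slope (F : fieldType) (u v : F) p e : u != 0 ->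
  (u - v) ^+ p = v ^+ p * u ^+ e -> (- (v / u - 1)) ^+ p = (v / u) ^+ p * u ^+ e.
Proof.
move=> u0 E; have -> : - (v / u - 1) = (u - v) / u by rewrite opprB mulrBl divff.
by rewrite !exprMn E mulrAC.
Qed.

Section Tangency.
Variables (K : fieldType) (D : curve K) (s : P1 K) (p e : nat).
Hypotheses (p1 : (1 < p)%N) (e0 : (0 < e)%N).
Implicit Types (X : surface K) (c : chart K).

(* With b = alpha and e = alpha p - q, the equation of the curve of part (2) in
   the chart (1/x, 1/y) at infinity. Each blow-up lowers b by one until b = 1,
   where the curve is no longer tangent to either axis and the next point has
   slope 1. *)
Definition tangency (b : nat) : {poly {poly K}} :=
  ('X^b - 'Y) ^+ p - 'Y ^+ p * 'X^e.

Lemma tangency_coef0 b : (0 < b)%N -> (tangency b)`_0 = (- 'X) ^+ p.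
Proof.
move=> b0; rewrite -horner_coef0 /tangency hornerD hornerN hornerM !horner_exp.
rewrite hornerD hornerN horner_exp hornerC !hornerX !expr0n.
by rewrite !eqn0Ngt b0 e0 mulr0 subr0 sub0r.
Qed.

Lemma tangency_neq0 b : (0 < b)%N -> (tangency b)`_0 != 0.
Proof. by move=> b0; rewrite tangency_coef0 // expf_neq0 // oppr_eq0 polyX_eq0. Qed.

Lemma tangency_coef01 b : (0 < b)%N -> (tangency b)`_0`_1 = 0.
Proof.
move=> b0; by rewrite tangency_coef0 // exprNn coefMXn p1.
Qed.

Lemma tangency_coef10 b : (0 < b)%N -> (tangency b)`_1`_0 = 0.
Proof.
move=> b0; rewrite -coef_swapXY -horner_coef0.
have -> : swapXY (tangency b) = ('Y ^+ b - 'X) ^+ p - 'X^p * 'Y ^+ e.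
  have E1 : swapXY (('X^b - 'Y) ^+ p) = ('Y ^+ b - 'X) ^+ p :> {poly {poly K}}.
    by rewrite rmorphXn rmorphB rmorphXn /= swapXY_X swapXY_Y.
  have E2 : swapXY ('Y ^+ p * 'X^e) = 'X^p * 'Y ^+ e :> {poly {poly K}}.
    by rewrite rmorphM !rmorphXn /= swapXY_X swapXY_Y.
  rewrite /tangency -E1 -E2; exact: raddfB.
rewrite hornerD hornerN hornerM !horner_exp hornerD hornerN horner_exp hornerC !hornerX.
rewrite expr0n eqn0Ngt (ltnW p1) mul0r !subr0 -exprM coefXn.
by have -> : (1 == b * p)%N = false by apply/eqP; nia.
Qed.

Lemma tangency_blowup b : (0 < b)%N ->
  sub2 'X ('X * ('Y + const11 0)) (tangency b.+1) = 'X^p * tangency b.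
Proof.
move=> b0; rewrite (_ : const11 0 = 0) ?addr0; last by rewrite /const11 polyC0.
set w := 'X * 'Y.
have E1 : sub2 'X w (('X^(b.+1) - 'Y) ^+ p) = ('X^(b.+1) - w) ^+ p.
  by rewrite ev2_exp ev2B ev2Xn ev2Y.
have E2 : sub2 'X w ('Y ^+ p * 'X^e) = w ^+ p * 'X^e by rewrite ev2M ev2Yn ev2Xn.
rewrite /tangency ev2B E1 E2 /w exprS -mulrBr !exprMn -mulrA.
by rewrite [RHS]mulrBr.
Qed.

(** With V = U (V' + 1) the factor U - V becomes - U V'. This moves the p-fold tangent direction
    onto an axis and leaves V'^p and U^e times units. *)
Lemma tangency_last :
  exists2 f, newton_edge p e f & sub2 'X ('X * ('Y + const11 1)) (tangency 1) = 'X^p * f.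
Proof.
have p00 : (0 < p)%N by exact: ltnW.
exists ('Y ^+ p * (-1) ^+ p + 'X^e * - ('Y + 1) ^+ p).
  apply: newton_edge_binomial p00 e0 _ _.
    by rewrite -!horner_coef0 !(horner_exp, hornerN, hornerC) signr_eq0.
  rewrite coefN coefN oppr_eq0 -!horner_coef0 horner_exp hornerD !hornerC horner_exp.
  by rewrite hornerD hornerX hornerC add0r expr1n oner_eq0.
rewrite (_ : const11 1 = 1); last by rewrite /const11 !polyC1.
set w := 'X * _.
have E1 : sub2 'X w (('X^1 - 'Y) ^+ p) = ('X - w) ^+ p.
  by rewrite ev2_exp ev2B ev2Xn ev2Y expr1.
have E2 : sub2 'X w ('Y ^+ p * 'X^e) = w ^+ p * 'X^e by rewrite ev2M ev2Yn ev2Xn.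
rewrite /tangency ev2B E1 E2 /w.
have -> : 'X - 'X * ('Y + 1) = 'X * - 'Y :> {poly {poly K}}.
  by rewrite mulrDr mulr1 opprD addrCA subrr addr0 mulrN.
rewrite !exprMn -mulrA -mulrBr; congr (_ * _).
congr (_ + _); first by rewrite [LHS]exprNn mulrC.
by rewrite [RHS]mulrN mulrC.
Qed.

Definition tangent_germ c (b : nat) (n : int) := exists ru rv,
  [/\ local_eq D s c ru rv (tangency b) n, ru != 0 /\ rv != 0, ord s ru = p%:Z
    & ord s rv = (b * p)%:Z].

Lemma tangent_germ_blowup c b n : (0 < b)%N -> tangent_germ c b.+1 n ->
  tangent_germ (c.1, c.2 / c.1 - const2 0) b (n - (p * p)%:Z).
Proof.
move=> b0 [ru [rv [Lf [ru0 rv0] oru orv]]].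
have E : rv / ru - const1 0 = rv / ru by rewrite /const1 polyC0 tofrac0 subr0.
have En : n - p%:Z * ord s ru = n - (p * p)%:Z by rewrite oru PoszM.
have := local_eq_blowup Lf ru0 (tangency_blowup b0) (tangency_neq0 b0).
rewrite {}E {}En => Lf'.
have iu0 := invr_neq0 ru0.
exists ru, (rv / ru); split; [exact: Lf' | | exact: oru |].
  by split; [exact: ru0 | exact: divf_neq0 rv0 ru0].
by rewrite (ordM s rv0 iu0) ordV oru orv; lia.
Qed.

Lemma tangent_germ_last c n : tangent_germ c 1 n ->
  germ D s (c.1, c.2 / c.1 - const2 1) p e (n - (p * p)%:Z).
Proof.
move=> [ru [rv [Lf [ru0 rv0] oru orv]]].
have [f bf Ef] := tangency_last.
have f0 : f`_0 != 0.
  by have [fp _ _] := bf; apply: contra_neq fp => ->; rewrite coef0.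
have En : n - p%:Z * ord s ru = n - (p * p)%:Z by rewrite oru PoszM.
have := local_eq_blowup Lf ru0 Ef f0; rewrite {}En => Lf'.
have iu0 := invr_neq0 ru0.
have q0 := divf_neq0 rv0 ru0.
have oq : ord s (rv / ru) = 0 by rewrite (ordM s rv0 iu0) ordV oru orv; lia.
have [_ _ /gen_vanish E _] := Lf.
have {}E : (ru - rv) ^+ p = rv ^+ p * ru ^+ e.
  apply/eqP; rewrite -subr_eq0 -E /tangency ev2B ev2_exp ev2B ev2M !ev2Xn ev2Yn.
  by rewrite (ev2Y (@const1 K) ru rv) expr1.
pose v := rv / ru - const1 1.
have c1 : const1 1 = 1 :> ratfun1 K by rewrite /const1 polyC1 tofrac1.
have Ev : (- v) ^+ p = (rv / ru) ^+ p * ru ^+ e.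
  rewrite /v c1; exact: (tangent_slope ru0 E).
have v0 : v != 0.
  have : (- v) ^+ p != 0 by rewrite Ev; exact: mulf_neq0 (expf_neq0 _ q0) (expf_neq0 _ ru0).
  by apply: contra_neq => ->; rewrite oppr0 expr0n eqn0Ngt (ltnW p1).
(* The orders of u and v only show that v / u has order 0. The order of the new coordinate comes
   from the equation of the curve, as p ord v = p e. *)
have ov : ord s v = e%:Z.
  have := congr1 (ord s) Ev.
  rewrite (ordM s (expf_neq0 _ q0) (expf_neq0 _ ru0)) !ordX ordN oq oru.
  by move: (ord s v) => o; nia.
exists ru, v, f; split; [exact: Lf' | by split | exact: oru | exact: ov | exact: bf].
Qed.

Hypothesis base0 : equation_in_L D (base_chart K) != 0.

(** There are b blow-ups of multiplicity p, the last of which moves to the point of slope 1. From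
    there on the germ has exponents p and e, and the Euclidean count applies. *)
Lemma tangent_germ_resolvable r b X c n : euclid_tail p e r -> (0 < b)%N ->
  one_point D X -> isolated D X s -> point_at X D s = c -> tangent_germ c b n ->
  resolvable D X s (n - (b * (p * p))%:Z - (p * e)%:Z + r%:Z).
Proof.
move=> tl; elim: b X c n => // b IH X c n _ X1 iX Ec tc.
have p00 : (0 < p)%N by exact: ltnW.
have [ru [rv [Lf [ru0 rv0] oru orv]]] := tc; have [Ru Rv _ _] := Lf.
have nsm : ~ smooth_at X D s.
  by move/(smooth_atE Ec Lf); rewrite tangency_coef10 // tangency_coef01 // eqxx => -[].
have [b0|b0] := posnP b.
  rewrite b0 in tc; have gc := tangent_germ_last tc.
  have [] := blowup_point X1 iX Ec Ru Rv ru0 rv0 _ (germ_passes p00 e0 gc).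
    by left; exists 1.
  move=> X1' iX' Ec' off; apply: resolvable_blowup nsm _ _; rewrite Ec //.
  have := germ_resolvable base0 tl p00 e0 X1' iX' Ec' gc.
  by rewrite b0; congr (resolvable _ _ _ _); lia.
have tc' := tangent_germ_blowup b0 tc.
have pc' : passes_through D s (c.1, c.2 / c.1 - const2 0).
  have [ru' [rv' [[Ru' Rv' _ _] [ru0' rv0'] oru' orv']]] := tc'.
  by apply/(passes_throughE s Ru' Rv'); split; right; rewrite ?oru' ?orv' // ltz_nat muln_gt0 b0.
have [] := blowup_point X1 iX Ec Ru Rv ru0 rv0 _ pc'.
  by left; exists 0.
move=> X1' iX' Ec' off; apply: resolvable_blowup nsm _ _; rewrite Ec //.
have := IH _ _ _ b0 X1' iX' Ec' tc'.
by congr (resolvable _ _ _ _); lia.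
Qed.
End Tangency.

(** * Arithmetic of the Euclidean algorithm *)

Section PuiseuxPair.
Local Open Scope nat_scope.

Lemma euclid_tail_sym a b r : euclid_tail a b r -> euclid_tail b a r.
Proof.
elim=> {a b r} [r|r|a b r a1 b0 _ IH|a b r a0 b1 _ IH]; try by constructor.
  by rewrite addnC; constructor.
by rewrite addnC; constructor.
Qed.

Lemma euclid_tail_ex a b : 0 < a -> 0 < b -> coprime a b -> exists r, euclid_tail a b r.
Proof.
have [n le_n] := ubnP (a + b); elim: n => // n IH in a b le_n * => a0 b0 cab.
have [a1|a1] := leqP a 1.
  by have -> : a = 1 by [lia]; exists b; constructor.
have [b1|b1] := leqP b 1.
  by have -> : b = 1 by [lia]; exists a; constructor.
case: (ltngtP a b) => [ab|ba|E]; last by move: cab; rewrite E /coprime gcdnn; lia.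
- have [||||r tl] := IH a (b - a); rewrite ?subn_gt0 //; [lia | |].
    by rewrite /coprime -(gcdnDl a (b - a)) subnKC // ltnW.
  by exists r; rewrite -(subnKC (ltnW ab)); constructor; rewrite ?subn_gt0.
- have [||||r tl] := IH (a - b) b; rewrite ?subn_gt0 //; [lia | |].
    by rewrite coprime_sym /coprime -(gcdnDl b (a - b)) subnKC 1?gcdnC // ltnW.
  by exists r; rewrite -(subnK (ltnW ba)); constructor; rewrite ?subn_gt0.
Qed.

Lemma euclid_tail_addn n a b r : 1 < a -> 0 < b -> euclid_tail a b r ->
  euclid_tail a (n * a + b) r.
Proof.
move=> a1 b0 tl; elim: n => // n IH.
by rewrite mulSn -addnA; constructor; rewrite // addn_gt0 b0 orbT.
Qed.

Lemma euclid_tail_pred m : 2 < m -> euclid_tail m m.-1 m.-1.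
Proof.
case: m => // m m2; rewrite -[m.+1]/(1 + m) /=.
by constructor; [ | lia | constructor].
Qed.

(** With c the residue of q modulo p, that of e is p - c. Both (p, c) and (p, p - c) reduce to the
    pair of c and p - c, hence have the same tail, unless c or p - c is 1, when one of the two may
    stop a step earlier. *)
Lemma euclid_tail_opp p q e n : 1 < p -> p < q -> 0 < e -> q + e = n * p -> coprime p q ->
  exists r1 r2, [/\ euclid_tail p q r1, euclid_tail p e r2
    & r2 + ((2 < p) && (p %| q - 1)) = r1 + ((2 < p) && (p %| q + 1))].
Proof.
move=> p1 pq e0 Ene cpq; have p0 := ltnW p1.
have [k [c [Eq cp]]] : exists k c, q = k * p + c /\ c < p.
  by exists (q %/ p), (q %% p); rewrite -divn_eq ltn_mod.
have c0 : 0 < c.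
  by rewrite lt0n; apply: contraTneq cpq => c0; rewrite Eq c0 addn0 /coprime gcdnMl neq_ltn p1 orbT.
have [k' Ee] : exists k', e = k' * p + (p - c).
  have kn : k < n by rewrite -(ltn_pmul2r p0); lia.
  exists (n - k.+1); rewrite mulnBl mulSn.
  have : k.+1 * p <= n * p by rewrite leq_mul2r kn orbT.
  by rewrite mulSn; lia.
have pc0 : 0 < p - c by rewrite subn_gt0.
have D1 : p %| q - 1 = (p %| c - 1) by rewrite Eq -addnBA // dvdn_addr // dvdn_mull.
have D2 : p %| q + 1 = (p %| c + 1) by rewrite Eq -addnA dvdn_addr // dvdn_mull.
have cpc : coprime p c by rewrite /coprime -(gcdnMDl k) -Eq.
clear Ene; subst e; rewrite D1 D2 {D1 D2}; move: Eq => ->.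
(* For c = 1 and p > 2 the tails are p for (p, 1) and p - 1 for (p, p - 1); for p = 2 the two pairs
   coincide. *)
have [c1|c1] := eqVneq c 1.
  rewrite c1 in pc0 *; rewrite subnn dvdn0 andbT.
  have [p2|p2] := ltnP 2 p.
    exists p, p.-1; split; [| | by rewrite gtnNdvd //; lia].
      by apply: euclid_tail_addn => //; constructor.
    by rewrite subn1; apply: euclid_tail_addn => //; [lia | exact: euclid_tail_pred].
  have -> : p = 2 by lia.
  by exists 2, 2; split=> //; apply: euclid_tail_addn => //; constructor.
have [cp1|cp1] := eqVneq c p.-1.
  have p2 : 2 < p by lia.
  have -> : p - c = 1 by lia.
  have E1 : c + 1 = p by lia.
  have nd : (p %| c - 1) = false by apply: gtnNdvd; lia.
  rewrite p2 nd E1 dvdnn.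
  exists p.-1, p; split; [| | by rewrite addn0 addn1 prednK].
    by rewrite cp1; apply: euclid_tail_addn => //; [lia | exact: euclid_tail_pred].
  by apply: euclid_tail_addn => //; constructor.
have cop : coprime c (p - c).
  by move: cpc; rewrite coprime_sym /coprime -{1}(subnKC (ltnW cp)) gcdnDl.
have [r tl] := euclid_tail_ex c0 pc0 cop.
have nd1 : (p %| c - 1) = false by apply: gtnNdvd; lia.
have nd2 : (p %| c + 1) = false by apply: gtnNdvd; lia.
exists r, r; split; last by rewrite nd1 nd2.
  apply: euclid_tail_addn => //; apply: euclid_tail_sym.
  by rewrite -(subnKC (ltnW cp)); constructor=> //; lia.
apply: euclid_tail_addn => //; apply: euclid_tail_sym.
rewrite -{2}(subnK (ltnW cp)); constructor=> //; first by lia.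
exact: euclid_tail_sym.
Qed.

(* B / b and a' / a are neighbouring fractions whose inverses lie in [r, r + 1].
   The mediants produced by undoing a Euclid step have the same property, with
   the same r. *)
Definition euclid_inv r a b := exists a' B,
  [/\ 0 < a', 0 < B, a' * b = a * B + 1, r * a' <= a & b <= (r + 1) * B].

Lemma euclid_tailP a b r : euclid_tail a b r -> 1 < a -> 1 < b ->
  1 < r /\ (euclid_inv r a b \/ euclid_inv r b a).
Proof.
elim=> {a b r} [r|r|a b r a1 b0 tl IH|a b r a0 b1 tl IH] // _ _.
- have [b1|b1] := ltnP 1 b.
    have [r1 [|] [c [d [c0 d0 E le1 le2]]]] := IH a1 b1; split=> //; [left|right].
      by exists c, (d + c); split; nia.
    by exists (c + d), d; split; nia.
  (* Run backwards, the algorithm first has both entries above 1 at the pair (a, a + 1). Its tail is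
     a, and both witnesses are 1. *)
  have Eb : b = 1 by lia.
  have Er : r = a by subst b; inversion tl; subst; lia.
  by subst; split=> //; left; exists 1, 1; split; lia.
- have [a1|a1] := ltnP 1 a.
    have [r1 [|] [c [d [c0 d0 E le1 le2]]]] := IH a1 b1; split=> //; [left|right].
      by exists (c + d), d; split; nia.
    by exists c, (d + c); split; nia.
  have Ea : a = 1 by lia.
  have Er : r = b by subst a; inversion tl; subst; lia.
  by subst; split=> //; right; exists 1, 1; split; lia.
Qed.

Lemma eq_one_mod a A x y : 0 < A -> A < a -> A + x * a = y * a + 1 -> A = 1.
Proof. by move=> A0 Aa E; case: (ltngtP x y) => xy; nia. Qed.

Lemma m_primesE a b a' b' : coprime a b -> 0 < a' < a -> 0 < b' < b ->
  a * b' + b * a' = a * b + 1 -> m_primes a b = (a', b').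
Proof.
move=> cab Ha Hb E; apply: xget_unique => [|[c d] /= [Hc Hd E']]; first by split.
have Ea : c = a'.
  apply: (@coprime_modn_mul_inj b a); rewrite 1?coprime_sym //; [lia | lia |].
  have := congr1 (modn^~ a) (etrans E' (esym E)).
  by rewrite ![a * _]mulnC !modnMDl.
by subst c; congr (_, _); apply/eqP; rewrite -(eqn_pmul2l (m := a)); [apply/eqP|]; lia.
Qed.

Lemma mE a b a' b' : coprime a b -> 0 < a' < a -> 0 < b' < b ->
  a * b' + b * a' = a * b + 1 ->
  m a b = a * b + maxn (a %/ (a - a')) (b %/ (b - b')).
Proof. by move=> cab Ha Hb E; rewrite /m (m_primesE cab Ha Hb E). Qed.

(** B plays the part of b - b'. From r >= 2 and r a' <= a the fraction a / (a - a') is at most 2, so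
    the maximum is the floor of b / B, where r < b / B <= r + 1. The upper bound is attained only
    for b = (r + 1) B, and then B divides a' b - a B = 1. *)
Lemma euclid_inv_floor r a b a' B : 1 < r -> 1 < a -> 1 < b ->
  0 < a' -> 0 < B -> a' * b = a * B + 1 -> r * a' <= a -> b <= (r + 1) * B ->
  [/\ a' < a, r * B < b
    & maxn (a %/ (a - a')) (b %/ B) = r + ((b == r + 1) && (b %| a + 1))].
Proof.
move=> r1 a1 b1 a'0 B0 E le1 le2.
have aa : a' < a by nia.
have rB : r * B < b by nia.
split=> //.
have le : a %/ (a - a') <= r.
  by rewrite -ltnS ltn_divLR; nia.
have Bb : B < b by apply: leq_ltn_trans rB; rewrite leq_pmull // ltnW.
have [Eb|nb] := eqVneq b ((r + 1) * B).
  have B1 : B = 1.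
    apply/eqP; rewrite -dvdn1 -(dvdn_addr 1 (dvdn_mull a (dvdnn B))) -E Eb.
    by rewrite dvdn_mull // dvdn_mull.
  have -> : (b == r + 1) && (b %| a + 1).
    have <- : a' * b = a + 1 by rewrite E B1 muln1.
    by rewrite dvdn_mull // {1}Eb B1 muln1 eqxx.
  by rewrite B1 divn1; lia.
have -> : (b == r + 1) && (b %| a + 1) = false.
  apply/negP => /andP[/eqP Er /dvdnP[k Ek]].
  (* If b divides a + 1, then a is -1 modulo b, and a' b = a B + 1 makes B equal to 1 modulo b. *)
  have B1 : B = 1.
    apply: (@eq_one_mod b B a' (k * B)) => //.
    by rewrite E mulnAC -Ek; lia.
  by case/eqP: nb; rewrite B1 Er muln1.
have -> : b %/ B = r.
  apply/eqP; rewrite eqn_leq leq_divRL // (ltnW rB) -ltnS ltn_divLR //.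
  by rewrite andbT ltn_neqAle -addn1 nb le2.
lia.
Qed.

(** The two orientations of [euclid_inv] account for the two correction terms. In the first, the
    extra 1 of [euclid_inv_floor] means b = a + 1; in the second, that a > 2 divides b + 1. In each
    orientation the other condition is impossible. *)
Lemma m_euclid a b r : 1 < a -> a < b -> coprime a b -> euclid_tail a b r ->
  m a b = a * b + r + ((2 < a) && (a %| b + 1)) + (b == a + 1).
Proof.
move=> a1 ab cab tl; have b1 := ltn_trans a1 ab.
have [r1 [|] [c [d [c0 d0 E le1 le2]]]] := euclid_tailP tl a1 b1.
  have [ca rd _] := euclid_inv_floor r1 a1 b1 c0 d0 E le1 le2.
  have db : d < b by apply: leq_ltn_trans rd; rewrite leq_pmull // ltnW.
  have adb : a * d <= a * b by rewrite leq_mul2l ltnW ?orbT.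
  have Em : m a b = a * b + maxn (a %/ (a - c)) (b %/ (b - (b - d))).
    by apply: mE => //; [lia | lia | rewrite mulnBr [b * c]mulnC E; lia].
  have [_ _ F] := euclid_inv_floor r1 a1 b1 c0 d0 E le1 le2.
  rewrite {}Em subKn ?(ltnW db) // {}F.
  (* If a divides b + 1, then c b = a d + 1 makes c equal to -1 modulo a, so c = a - 1, against 2 c
     <= r c <= a. *)
  have -> : (2 < a) && (a %| b + 1) = false.
    apply/negP => /andP[a2 /dvdnP[k Ek]].
    have Eq : c * k * a = c + a * d + 1 by rewrite -mulnA -Ek mulnDr E; lia.
    have ac : a - c = 1 by apply: (@eq_one_mod a (a - c) (c * k) (d + 1)); lia.
    have : 2 * c <= r * c by rewrite leq_mul2r r1 orbT.
    by lia.
  suff -> : (b == r + 1) && (b %| a + 1) = (b == a + 1) by rewrite addn0 addnA.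
  apply/idP/eqP => [/andP[_ /dvdn_leq]|Eb]; first by lia.
  rewrite Eb dvdnn andbT; apply/eqP.
  have c1 : c = 1 by apply: (@eq_one_mod a c c d); nia.
  by nia.
have [da rd _] := euclid_inv_floor r1 b1 a1 c0 d0 E le1 le2.
have db : d < a by apply: leq_ltn_trans rd; rewrite leq_pmull // ltnW.
have adb : b * d <= b * a by rewrite leq_mul2l ltnW ?orbT.
have Em : m a b = a * b + maxn (a %/ (a - (a - d))) (b %/ (b - c)).
  by apply: mE => //; [lia | lia | rewrite mulnBr [a * c]mulnC E; lia].
have [_ _ F] := euclid_inv_floor r1 b1 a1 c0 d0 E le1 le2.
rewrite {}Em subKn ?(ltnW db) // maxnC {}F addnA.
(* With b = a + 1 the relation c a = b d + 1 gives d = a - 1, against r d < a. *)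
have -> : (b == a + 1) = false.
  by apply/negP => /eqP Eb; case: (leqP c d) => cd; nia.
rewrite addn0; congr (_ + nat_of_bool _).
apply/andP/andP => [[/eqP Ea dv]|[a2 /dvdnP[k Ek]]]; first by split=> //; lia.
have d1 : d = 1 by apply: (@eq_one_mod a d c (k * d)); nia.
by rewrite Ek dvdn_mull //; split=> //; apply/eqP; nia.
Qed.
End PuiseuxPair.

(** * Uniqueness of the Puiseux pair *)

Lemma coprime_multiple n a : (1 < a)%N -> coprime a (n * a) = false.
Proof. by move=> a1; rewrite /coprime gcdnMl; apply/eqP; lia. Qed.

Section PuiseuxUnique.
Variables (K : fieldType) (s : P1 K).
Local Notation ev1 := (ev2 (@const1 K)).
Implicit Types (f g h : {poly {poly K}}) (ru rv rh : ratfun1 K).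

Definition puiseux_coords ru rv (a b : nat) := exists g h,
  [/\ g`_0`_0 = 0, h`_0`_0 = 0, g`_1`_0 * h`_0`_1 - g`_0`_1 * h`_1`_0 != 0,
      ord s (ev1 ru rv g) = a%:Z & ord s (ev1 ru rv h) = b%:Z].

Lemma has_puiseux_pairP (D : curve K) (X : surface K) c ru rv a b : point_at X D s = c ->
  restricts D c.1 ru -> restricts D c.2 rv ->
  has_puiseux_pair X D s a b <->
  [/\ (1 < a < b)%N, coprime a b & puiseux_coords ru rv a b].
Proof.
move=> Ec Ru Rv.
have E g : Defs.restrict D (eval2 (@const2 K) g c.1 c.2) = ev1 ru rv g.
  by apply: restrictE; rewrite eval2E; exact: restricts_ev2.
rewrite /has_puiseux_pair Ec; split=> -[Hab cab [g [h [g0 h0 det Eg Eh]]]];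
  split=> //; exists g, h.
  by rewrite -!E; split.
by rewrite !E; split.
Qed.

Lemma puiseux_coords_swap ru rv a b : puiseux_coords ru rv a b -> puiseux_coords rv ru a b.
Proof.
move=> [g [h [g0 h0 det Eg Eh]]]; exists (swapXY g), (swapXY h).
rewrite !coef_swapXY (ev2_swapXY _ rv ru g) (ev2_swapXY _ rv ru h); split=> //.
by move: det; rewrite -oppr_eq0 opprB.
Qed.

Lemma poly2_decomp f : exists g (c : {poly K}),
  [/\ f = 'X * g + c%:P, f`_0 = c & forall i, f`_i.+1 = g`_i].
Proof.
elim/poly_ind: f => [|g c _].
  by exists 0, 0; rewrite mulr0 addr0; split=> [||i]; rewrite ?coef0.
exists g, c; split=> [||i]; first by rewrite [g * _]mulrC.
  by rewrite coefD coefMX coefC add0r.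
by rewrite coefD coefMX coefC addr0.
Qed.

Section Orders.
Variables (ru rh : ratfun1 K) (a b : nat).
Hypotheses (ru0 : ru != 0) (rh0 : rh != 0).
Hypotheses (oru : ord s ru = a%:Z) (orh : ord s rh = b%:Z).
Hypotheses (a0 : (0 < a)%N) (b0 : (0 < b)%N).

Lemma ord_ev2_ge0 f : 0 <= ord s (ev1 ru rh f).
Proof.
elim/poly2_ind: f => [k|||f g If Ig|f g If Ig].
- by rewrite ev2C ord_const.
- by rewrite (ev2X (@const1 K) ru rh) oru.
- by rewrite (ev2Y (@const1 K) ru rh) orh.
- rewrite ev2D; have [->|n0] := eqVneq (ev1 ru rh f + ev1 ru rh g) 0; first by rewrite ord_0.
  exact: (ordD_ge n0 (fun _ => If) (fun _ => Ig)).
- rewrite ev2M; have [->|n1] := eqVneq (ev1 ru rh f) 0; first by rewrite mul0r ord_0.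
  have [->|n2] := eqVneq (ev1 ru rh g) 0; first by rewrite mulr0 ord_0.
  by rewrite (ordM s n1 n2) addr_ge0.
Qed.

Lemma ev2_vanishes f : f`_0`_0 = 0 -> vanishes_at s (ev1 ru rh f).
Proof.
have [g [c [-> -> _]]] := poly2_decomp f.
elim/poly_ind: c => [|c k _]; rewrite ?coefD ?coefMX ?coefC /= ?add0r => k0.
  rewrite addr0 ev2M (ev2X (@const1 K) ru rh).
  by apply: vanishes_mulr (ord_ev2_ge0 g); right; rewrite oru.
rewrite k0 addr0 ev2D ev2M (ev2X (@const1 K) ru rh); apply: vanishesD.
  by apply: vanishes_mulr (ord_ev2_ge0 g); right; rewrite oru.
rewrite polyCM ev2M (ev2Y (@const1 K) ru rh) mulrC.
by apply: vanishes_mulr (ord_ev2_ge0 _); right; rewrite orh.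
Qed.

Lemma ord_ev2_unit f : f`_0`_0 != 0 -> ev1 ru rh f != 0 /\ ord s (ev1 ru rh f) = 0.
Proof.
move=> f0; set k := f`_0`_0 in f0 *.
have : vanishes_at s (ev1 ru rh (f - const11 k)).
  by apply: ev2_vanishes; rewrite !coefB /const11 coefC coefC subrr.
rewrite ev2B ev2C => v.
have k0 : const1 k != 0 by rewrite /const1 tofrac_eq0 polyC_eq0.
rewrite -(subrK (const1 k) (ev1 ru rh f)) addrC -(ord_const s k).
apply: ordD_lt k0 _ => n; rewrite ord_const; exact: vanishes_neq0 n v.
Qed.

Lemma ord_ev2_linear f : (a < b)%N -> f`_0`_0 = 0 -> f`_1`_0 != 0 ->
  ord s (ev1 ru rh f) = a%:Z.
Proof.
move=> ab; have [g [c [-> Ec Eg]]] := poly2_decomp f.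
rewrite Ec Eg => c0 g0; have [ug og] := ord_ev2_unit g0.
elim/poly_ind: c c0 {Ec Eg} => [|c k _]; rewrite ?coefD ?coefMX ?coefC /= ?add0r => k0.
  by rewrite addr0 ev2M (ev2X (@const1 K) ru rh) (ordM s ru0 ug) og addr0.
rewrite k0 addr0 ev2D ev2M (ev2X (@const1 K) ru rh) polyCM ev2M (ev2Y (@const1 K) ru rh).
have o1 : ord s (ru * ev1 ru rh g) = a%:Z by rewrite (ordM s ru0 ug) og addr0.
rewrite -[RHS]o1; apply: (proj2 (ordD_lt _ _)); first exact: mulf_neq0 ru0 ug.
move=> n; have n1 : ev1 ru rh c%:P != 0 by apply: contra_neq n => ->; rewrite mul0r.
by rewrite o1 (ordM s n1 rh0) orh; have := ord_ev2_ge0 c%:P; ord_lia.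
Qed.

Lemma poly_Xn_factor (c : {poly K}) : c != 0 -> exists n d, c = 'X^n * d /\ d`_0 != 0.
Proof.
elim/poly_ind: c => [|c k IH]; first by rewrite eqxx.
have [->|k0] := eqVneq k 0.
  rewrite addr0 mulf_eq0 polyX_eq0 orbF => /IH[n [d [-> d0]]].
  by exists n.+1, d; split=> //; rewrite exprS mulrC mulrA.
move=> _; exists 0%N, (c * 'X + k%:P); split; first by rewrite mul1r.
by rewrite coefD coefMX coefC add0r.
Qed.

(** f is V times a unit plus a polynomial in U, itself 0 or U^n times a unit. The two summands have
    orders b and n a, which differ by coprimality, so nothing cancels. *)
Lemma ord_ev2_no_linear f : (1 < a)%N -> coprime a b -> f`_0`_0 = 0 -> f`_0`_1 != 0 ->
  ord s (ev1 ru rh f) = b%:Z \/ exists n, ord s (ev1 ru rh f) = (n * a)%:Z.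
Proof.
move=> a1 cab f00 f01; rewrite -(swapXYK f) ev2_swapXY.
have [g [c [E Ec Eg]]] := poly2_decomp (swapXY f).
have g0 : (swapXY g)`_0`_0 != 0 by rewrite coef_swapXY -Eg coef_swapXY.
have [ug og] := ord_ev2_unit g0; rewrite ev2_swapXY in ug og.
rewrite E ev2D ev2M (ev2X (@const1 K) rh ru).
have o1 : ord s (rh * ev1 rh ru g) = b%:Z by rewrite (ordM s rh0 ug) og addr0.
have n1 : rh * ev1 rh ru g != 0 by exact: mulf_neq0 rh0 ug.
have [->|c0] := eqVneq c 0; first by left; rewrite ev2_0 addr0.
have [n [d [Ed d0]]] := poly_Xn_factor c0.
have d0' : (swapXY d%:P)`_0`_0 != 0 by rewrite coef_swapXY coefC.
have [ud od] := ord_ev2_unit d0'; rewrite ev2_swapXY in ud od.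
have E2 : ev1 rh ru c%:P = ru ^+ n * ev1 rh ru d%:P.
  by rewrite Ed polyCM ev2M polyC_exp (ev2Yn (@const1 K) rh ru).
have run0 : ru ^+ n != 0 by exact: expf_neq0 n ru0.
have o2 : ord s (ru ^+ n * ev1 rh ru d%:P) = (n * a)%:Z.
  by rewrite (ordM s run0 ud) ordX oru od addr0 PoszM.
have n2 : ru ^+ n * ev1 rh ru d%:P != 0 by exact: mulf_neq0 run0 ud.
rewrite E2; case: (ltngtP b (n * a)%N) => H.
- by left; rewrite (proj2 (ordD_lt n1 _)) // => _; rewrite o1 o2 ltz_nat.
- right; exists n; rewrite addrC (proj2 (ordD_lt n2 _)) // => _; by rewrite o1 o2 ltz_nat.
- by rewrite H (coprime_multiple n a1) in cab.
Qed.

(** A coordinate with a linear U-term has order a, and one with a linear V-term has order a, b or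
    another multiple of a. The nonzero determinant provides both terms, distinctness of the orders
    separates them, and coprimality excludes the multiples of a. *)
Lemma puiseux_coords_unique a' b' : (1 < a < b)%N -> coprime a b ->
  (1 < a' < b')%N -> coprime a' b' -> puiseux_coords ru rh a' b' -> (a', b') = (a, b).
Proof.
move=> /andP[a1 ab] cab /andP[a1' ab'] cab' [g [h [g0 h0 det Eg Eh]]].
have ncop n : coprime a (n * a) -> False by rewrite (coprime_multiple n a1).
have [g10|g10] := eqVneq g`_1`_0 0.
  rewrite g10 mul0r sub0r oppr_eq0 mulf_eq0 negb_or in det; case/andP: det => g01 h10.
  have := ord_ev2_linear ab h0 h10; rewrite Eh => -[Eb].
  have [|[n]] := ord_ev2_no_linear a1 cab g0 g01; rewrite Eg => -[Ea].
    by lia.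
  by case: (ncop n); rewrite -Ea -Eb coprime_sym.
have := ord_ev2_linear ab g0 g10; rewrite Eg => -[Ea].
have [h10|h10] := eqVneq h`_1`_0 0.
  rewrite h10 mulr0 subr0 mulf_eq0 negb_or in det; case/andP: det => _ h01.
  have [|[n]] := ord_ev2_no_linear a1 cab h0 h01; rewrite Eh => -[Eb].
    by rewrite Ea Eb.
  by case: (ncop n); rewrite -Eb -Ea.
by have := ord_ev2_linear ab h0 h10; rewrite Eh => -[Eb]; lia.
Qed.
End Orders.

(** Adding k U^n with n > 1 to V changes no linear term. This replaces a chart coordinate whose
    order need not be prime to that of u by an adapted one. *)
Lemma puiseux_coords_shear ru rv rh k n a b : (1 < n)%N -> rv = rh + const1 k * ru ^+ n ->
  puiseux_coords ru rv a b -> puiseux_coords ru rh a b.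
Proof.
move=> n1 Erv [g [h [g0 h0 det Eg Eh]]].
pose w := 'Y + const11 k * 'X^n.
have Ew : ev1 ru rh w = rv.
  by rewrite /w ev2D ev2M (ev2Y (@const1 K) ru rh) (ev2Xn (@const1 K) ru rh) ev2C Erv.
have w0 : w`_0`_0 = 0.
  by rewrite /w coefD coefC /= mulrC coefXnM ltnW // addr0 coefX.
have H f : f`_0`_0 = 0 -> [/\ (sub2 'X w f)`_0`_0 = 0, (sub2 'X w f)`_1`_0 = f`_1`_0
  & (sub2 'X w f)`_0`_1 = f`_0`_1].
  have X0 : ('X : {poly {poly K}})`_0`_0 = 0 by rewrite coefX coef0.
  move=> f0; rewrite (sub2_origin _ X0 w0).
  have [f' [c [Ef Ec Ei]]] := poly2_decomp f.
  rewrite Ei Ec in f0 *.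
  have [d Ed] : exists d, c = d * 'X.
    elim/poly_ind: c f0 {Ef Ec} => [|d e _]; first by exists 0; rewrite mul0r.
    by rewrite coefD coefMX coefC add0r => /= ->; exists d; rewrite addr0.
  have E : sub2 'X w f =
      'X^1 * sub2 'X w f' + ('Y ^+ 1 * sub2 'X w d%:P + 'X^n * (const11 k * sub2 'X w d%:P)).
    have E1 : sub2 'X w ('X * f') = 'X * sub2 'X w f' by rewrite ev2M ev2X.
    have E2 : sub2 'X w ('Y * d%:P) = w * sub2 'X w d%:P by rewrite ev2M ev2Y.
    rewrite Ef Ed [d * 'X]mulrC polyCM ev2D E1 E2 !expr1 /w mulrDl; congr (_ + (_ + _)).
    by rewrite mulrA; congr (_ * _); rewrite mulrC.
  rewrite E !coefD !coef_XnM !coef_YnM /= (ltnW n1) n1 !add0r !addr0.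
  rewrite (sub2_origin f' X0 w0) (sub2_origin d%:P X0 w0) Ed !coefMX coefC !eqxx.
  by split.
have [g00 g10 g01] := H g g0; have [h00 h10 h01] := H h h0.
exists (sub2 'X w g), (sub2 'X w h); rewrite g00 h00 g10 g01 h10 h01.
by rewrite !ev2_sub2 (ev2X (@const1 K) ru rh) Ew; split.
Qed.

Lemma puiseux_coords_shear_ex ru rv rh k n a b : (1 < n)%N ->
  rv = rh + const1 k * ru ^+ n -> ord s ru = a%:Z -> ord s rh = b%:Z ->
  puiseux_coords ru rv a b.
Proof.
move=> n1 Erv oru orh; have n0 := ltnW n1.
have Erh : ev1 ru rv ('Y - const11 k * 'X^n) = rh.
  rewrite ev2B ev2M (ev2Y (@const1 K) ru rv) (ev2Xn (@const1 K) ru rv) ev2C Erv.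
  exact: addrK.
exists 'X, ('Y - const11 k * 'X^n); rewrite (ev2X (@const1 K) ru rv) Erh; split=> //.
- by rewrite coefX coef0.
- by rewrite coefB coefC /= mulrC coefXnM n0 subr0 coefX.
have h0 : (const11 k * 'X^n)`_0 = 0 by rewrite mulrC coefXnM n0.
have h01 : ('Y - const11 k * 'X^n)`_0`_1 = 1 by rewrite coefB h0 subr0 coefC coefX.
by rewrite h01 !coefX coefC coef0 mulr1 mul0r subr0 oner_eq0.
Qed.

Lemma puiseux_pair_shear (D : curve K) X c ru rv rh k n a b : point_at X D s = c ->
  restricts D c.1 ru -> restricts D c.2 rv ->
  (1 < n)%N -> rv = rh + const1 k * ru ^+ n -> ru != 0 -> rh != 0 ->
  ord s ru = a%:Z -> ord s rh = b%:Z -> (1 < a < b)%N -> coprime a b ->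
  puiseux_pair X D s = (a, b).
Proof.
move=> Ec Ru Rv n1 Erv ru0 rh0 oru orh Hab cab; have /andP[a1 ab] := Hab.
apply: xget_unique => [|[a' b']] /=.
  apply/(has_puiseux_pairP _ _ Ec Ru Rv); split=> //.
  exact: (puiseux_coords_shear_ex n1 Erv oru orh).
move=> /(has_puiseux_pairP _ _ Ec Ru Rv)[Hab' cab' /(puiseux_coords_shear n1 Erv)].
exact: (puiseux_coords_unique ru0 rh0 oru orh (ltnW a1) (ltn_trans (ltnW a1) ab) Hab cab Hab' cab').
Qed.

Lemma puiseux_pair_swap (D : curve K) X c ru rv a b : point_at X D s = c ->
  restricts D c.1 ru -> restricts D c.2 rv -> ru != 0 -> rv != 0 ->
  ord s ru = b%:Z -> ord s rv = a%:Z -> (1 < a < b)%N -> coprime a b ->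
  puiseux_pair X D s = (a, b).
Proof.
move=> Ec Ru Rv ru0 rv0 oru orv Hab cab; have /andP[a1 ab] := Hab.
(* The trivial shear, k = 0 with exponent 2, after exchanging the two coordinates. *)
have E : ru = ru + const1 0 * rv ^+ 2 by rewrite /const1 polyC0 tofrac0 mul0r addr0.
apply: xget_unique => [|[a' b']] /=.
  apply/(has_puiseux_pairP _ _ Ec Ru Rv); split; [exact: Hab | exact: cab |].
  exact: puiseux_coords_swap (puiseux_coords_shear_ex (ltnSn 1) E orv oru).
move=> /(has_puiseux_pairP _ _ Ec Ru Rv)[Hab' cab' /puiseux_coords_swap].
exact: (puiseux_coords_unique rv0 ru0 orv oru (ltnW a1) (ltn_trans (ltnW a1) ab) Hab cab Hab' cab').
Qed.

End PuiseuxUnique.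

(** * Gaps and curves with polynomial parametrization *)

Section Gap.
Variables (K : fieldType) (D : curve K).

(** Resolving at s leaves the points of all other parameters in place, so the cusp is t, with the
    Puiseux pair and the contribution to D . D that it has on X, and only s and t contribute. *)
Lemma gap_resolve X s t n n' a b : s <> t ->
  resolvable D X s n -> ~ smooth_at X D t -> local_degree D X t = n' ->
  puiseux_pair X D t = (a, b) ->
  (forall r, r <> s -> r <> t -> smooth_at X D r /\ local_degree D X r = 0) ->
  gap (resolve X D s) D = (m a b)%:Z - (n + n').
Proof.
move=> st /resolveP[sm off dn] nsm dn' pp reg; set Y := resolve X D s in sm off dn *.
have ts : t <> s by move=> E; exact: st.
have smE r : r <> s -> smooth_at Y D r = smooth_at X D r.
  by move=> rs; rewrite /smooth_at off.
have degE r : r <> s -> local_degree D Y r = local_degree D X r.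
  by move=> rs; rewrite /local_degree off.
have Ec : cusp Y D = t.
  apply: xget_unique => [|r]; first by rewrite /= smE.
  have [->|/eqP rs] := eqVneq r s; first by move=> /(_ sm).
  have [->//|/eqP rt] := eqVneq r t.
  by rewrite /= smE // => /(_ (proj1 (reg r rs rt))).
have Ep : puiseux_pair Y D t = (a, b).
  by rewrite -pp /puiseux_pair /has_puiseux_pair off.
rewrite /gap Ec Ep; congr (_ - _).
have Z r : r \notin [:: s; t] -> local_degree D Y r = 0.
  rewrite !inE negb_or => /andP[/eqP rs /eqP rt].
  by rewrite degE //; exact: (proj2 (reg r rs rt)).
rewrite /self_intersection -(@fsbig_widen _ _ _ _ [set` [:: s; t]]) //; last first.
  by move=> r /= [_ /negP]; exact: Z.
rewrite -fsbig_seq /= ?inE ?andbT; last exact/eqP.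
by rewrite !big_cons big_nil addr0; congr (_ + _); [exact: dn | rewrite -dn' -degE].
Qed.

Lemma equation_baseE F : gen (@const1 K) D.1 D.2 F ->
  exists2 k : K, k != 0 & equation_in_L D (base_chart K) = const2 k * F%:F.
Proof.
move=> G.
have [k k0 E] := @equation_scalar K D (base_chart K) _ _ F (restricts_x D) (restricts_y D) G.
exists k => //; rewrite /equation_in_L E eval2E ev2M ev2C; congr (_ * _); exact: ev2_tofrac.
Qed.

(** Allows the order to be computed against an explicit affine equation F: the constant relating F
    to the chosen equation has order 0. *)
Lemma local_eq_intro s c ru rv F f w rw n : gen (@const1 K) D.1 D.2 F ->
  restricts D c.1 ru -> restricts D c.2 rv -> gen (@const1 K) ru rv f ->
  ev2 (@const2 K) c.1 c.2 f = w * F%:F -> restricts D w rw -> rw != 0 -> ord s rw = n ->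
  local_eq D s c ru rv f n.
Proof.
move=> GF Ru Rv G Ew Rw rw0 on; split=> //.
have [k k0 Ek] := equation_baseE GF.
have k1 : const1 k != 0 by rewrite /const1 tofrac_eq0 polyC_eq0.
have k2 : const2 k != 0 by rewrite /const2 tofrac_eq0 polyC_eq0 polyC_eq0.
exists (w / const2 k), (rw / const1 k); split.
- by rewrite Ew Ek mulrA divfK.
- exact: restricts_div Rw (restricts_const D k) k1.
- exact: divf_neq0 rw0 k1.
- by rewrite (ordM s rw0 (invr_neq0 k1)) ordV ord_const subr0.
Qed.

Definition affine_point (a b : K) : chart K := (xL K - const2 a, yL K - const2 b).

Lemma local_eq_affine s a b F : gen (@const1 K) D.1 D.2 F ->
  local_eq D s (affine_point a b) (D.1 - const1 a) (D.2 - const1 b)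
    (sub2 ('X + const11 a) ('Y + const11 b) F) 0.
Proof.
move=> G; set f := sub2 _ _ F.
apply: (@local_eq_intro _ _ _ _ F _ 1 1) => //=.
- exact: restrictsB (restricts_x D) (restricts_const D a).
- exact: restrictsB (restricts_y D) (restricts_const D b).
- apply: (@gen_auto K _ (@const1 K) D.1 D.2 F _ _ _ _ ('X - const11 a) ('Y - const11 b) G).
  + by rewrite ev2D (ev2X (@const1 K) (D.1 - const1 a)) ev2C subrK.
  + by rewrite ev2D (ev2Y (@const1 K) (D.1 - const1 a)) ev2C subrK.
  + have E1 : sub2 ('X + const11 a) ('Y + const11 b) 'X = 'X + const11 a by exact: ev2X.
    have E2 : sub2 ('X + const11 a) ('Y + const11 b) (const11 a) = const11 a by exact: ev2C.
    by rewrite ev2B E1 E2 addrK.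
  + have E1 : sub2 ('X + const11 a) ('Y + const11 b) 'Y = 'Y + const11 b by exact: ev2Y.
    have E2 : sub2 ('X + const11 a) ('Y + const11 b) (const11 b) = const11 b by exact: ev2C.
    by rewrite ev2B E1 E2 addrK.
- rewrite mul1r -[RHS]ev2_tofrac /f ev2_sub2.
  have -> : ev2 (@const2 K) (xL K - const2 a) (yL K - const2 b) ('X + const11 a) = xL K.
    by rewrite ev2D (ev2X (@const2 K) (xL K - const2 a)) ev2C subrK.
  have -> // : ev2 (@const2 K) (xL K - const2 a) (yL K - const2 b) ('Y + const11 b) = yL K.
  by rewrite ev2D (ev2Y (@const2 K) (xL K - const2 a)) ev2C subrK.
- by have := restricts_poly D 1; rewrite tofrac1 ev2_1.
- by rewrite oner_eq0.
- exact: ord_1.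
Qed.
End Gap.

(** * Points of the two surfaces on a curve with polynomial parametrization *)

Section PolynomialCurves.
Variables (K : fieldType) (P Q : {poly K}).
Hypotheses (P1' : (1 < size P)%N) (Q1 : (1 < size Q)%N).
Let D : curve K := (P%:F, Q%:F).

Let P0 : P != 0.
Proof. by apply: contraTneq P1' => ->; rewrite size_poly0. Qed.

Let Q0 : Q != 0.
Proof. by apply: contraTneq Q1 => ->; rewrite size_poly0. Qed.

Let PF0 : P%:F != 0 :> ratfun1 K.
Proof. by rewrite tofrac_eq0. Qed.

Let QF0 : Q%:F != 0 :> ratfun1 K.
Proof. by rewrite tofrac_eq0. Qed.

Lemma pole_None (f : {poly K}) : (1 < size f)%N -> ord None (f%:F : ratfun1 K) < 0.
Proof.
move=> f1; have f0 : f != 0 by apply: contraTneq f1 => ->; rewrite size_poly0.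
by rewrite ord_poly_None //; move: f1; move: (size f) => i; lia.
Qed.

Lemma affine_passes s a b : passes_through D s (affine_point a b) <->
  exists z, [/\ s = Some z, a = P.[z] & b = Q.[z]].
Proof.
have Ra : restricts D (affine_point a b).1 (P%:F - const1 a).
  exact: restrictsB (restricts_x D) (restricts_const D a).
have Rb : restricts D (affine_point a b).2 (Q%:F - const1 b).
  exact: restrictsB (restricts_y D) (restricts_const D b).
split=> [/(passes_throughE s Ra Rb)[va vb]|[z [-> Ea Eb]]]; last first.
  by apply/(passes_throughE (Some z) Ra Rb); split; apply/vanishes_horner.
case: s va vb => [z|] va vb; first by exists z; split=> //; exact/vanishes_horner.
by have := ord_ge0_of_value va; have := pole_None P1'; ord_lia.
Qed.

Lemma restricts_invx : restricts D (xL K)^-1 (P%:F)^-1.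
Proof. exact: restrictsV (restricts_x D) PF0. Qed.

Lemma restricts_invy : restricts D (yL K)^-1 (Q%:F)^-1.
Proof. exact: restrictsV (restricts_y D) QF0. Qed.

Lemma vanishes_inv s (f : {poly K}) : (f%:F : ratfun1 K) != 0 ->
  vanishes_at s (f%:F : ratfun1 K)^-1 -> s = None.
Proof.
move=> f0 v; case: s v => // z v.
by have := vanishes_neq0 (invr_neq0 f0) v; rewrite ordV; have := ord_poly_ge0 z f; ord_lia.
Qed.

Lemma inv_passes s c w (f : {poly K}) : (f%:F : ratfun1 K) != 0 ->
  restricts D w (f%:F)^-1 -> c.1 = w \/ c.2 = w -> passes_through D s c -> s = None.
Proof.
move=> f0 R E [ru [rv [Ru Rv vu vv]]].
case: E => E; rewrite E in Ru Rv; apply: (vanishes_inv f0).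
  by rewrite (restricts_unique R Ru).
by rewrite (restricts_unique R Rv).
Qed.

Section PointsOn.
Variables (X : surface K) (c : chart K).
Hypothesis X_affine : forall a b, X (affine_point a b).
Hypothesis X_infty : X c.
Hypothesis c_None : passes_through D None c.
Hypothesis X_passes : forall d s, X d -> passes_through D s d ->
  (exists a b, d = affine_point a b) \/ (d = c /\ s = None).

Lemma one_point_polynomial : one_point D X.
Proof.
case=> [z|].
  exists (affine_point P.[z] Q.[z]) => d; split=> [[Xd pd]|->]; last first.
    by split=> //; apply/affine_passes; exists z.
  case: (X_passes Xd pd) => [[a [b Ed]]|[_ //]]; rewrite Ed in pd *.
  by have [z' [[->] -> ->]] := (affine_passes _ _ _).1 pd.
exists c => d; split=> [[Xd pd]|->] //.
case: (X_passes Xd pd) => [[a [b Ed]]|[-> //]]; rewrite Ed in pd *.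
by have [z' [//]] := (affine_passes _ _ _).1 pd.
Qed.

Lemma point_at_affine z : point_at X D (Some z) = affine_point P.[z] Q.[z].
Proof.
symmetry; apply/(point_atP (Some z) _ one_point_polynomial); split=> //.
by apply/affine_passes; exists z.
Qed.

Lemma point_at_None : point_at X D None = c.
Proof. by symmetry; apply/(point_atP None _ one_point_polynomial). Qed.

Lemma isolated_Some z : (forall z', P.[z'] = P.[z] -> z' = z) -> isolated D X (Some z).
Proof.
move=> inj s' s'z E.
have [_] := (point_atP s' _ one_point_polynomial).2 (erefl (point_at X D s')).
rewrite E point_at_affine => /affine_passes[z' [Es' EP _]].
by apply: s'z; rewrite Es' (inj z').
Qed.

Lemma isolated_None : isolated D X None.
Proof.
case=> // z _ E.
have [_] := (point_atP None _ one_point_polynomial).2 (erefl (point_at X D None)).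
by rewrite -E point_at_affine => /affine_passes[z' [//]].
Qed.
End PointsOn.

Lemma CP2E d : CP2 d <-> [\/ exists a b : K, d = affine_point a b,
  exists b : K, d = ((xL K)^-1, yL K / xL K - const2 b) | d = ((yL K)^-1, xL K / yL K)].
Proof.
by split=> [[[|]|]|[|[b ->]|->]]; [constructor 1 | constructor 2 | constructor 3
 | left; left | left; right; exists b | right].
Qed.

Lemma CP1xCP1E d : CP1xCP1 d <-> [\/ exists a b : K, d = affine_point a b,
  exists b : K, d = ((xL K)^-1, yL K - const2 b),
  exists a : K, d = (xL K - const2 a, (yL K)^-1) | d = ((xL K)^-1, (yL K)^-1)].
Proof.
by split=> [[[[|]|]|]|[|||]]; [constructor 1 | constructor 2 | constructor 3 | constructor 4
 | left; left; left | left; left; right | left; right | right].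
Qed.

(** As deg Q > deg P, the function y / x has a pole at infinity, which rules out the points
    [1 : b : 0] and leaves [0 : 1 : 0]. *)
Lemma CP2_passes : (size P < size Q)%N ->
  passes_through D None ((yL K)^-1, xL K / yL K) /\
  forall d s, CP2 d -> passes_through D s d ->
    (exists a b, d = affine_point a b) \/ (d = ((yL K)^-1, xL K / yL K) /\ s = None).
Proof.
move=> PQ; split.
  exists (Q%:F)^-1, (P%:F / Q%:F); split=> /=.
  - exact: restricts_invy.
  - exact: restricts_div (restricts_x D) (restricts_y D) QF0.
  - by right; rewrite ordV; have := pole_None Q1; ord_lia.
  - right; rewrite (ordM None PF0 (invr_neq0 QF0)) ordV !ord_poly_None //.
    by move: PQ; move: (size P) (size Q) => i j; lia.
move=> d s /CP2E[E|[b Ed]|Ed] pd; first by left.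
  have Es := inv_passes PF0 restricts_invx (or_introl (congr1 fst Ed)) pd.
  have [ru [rv [_]]] := pd; rewrite Ed Es /= => Rv _ vv.
  have Rv' := restrictsB (restricts_div (restricts_y D) (restricts_x D) PF0) (restricts_const D b).
  rewrite (restricts_unique Rv Rv') in vv.
  have := ord_ge0_of_value vv.
  rewrite (ordM None QF0 (invr_neq0 PF0)) ordV !ord_poly_None //.
  by move: PQ; move: (size P) (size Q) => i j; lia.
by right; split=> //; exact: inv_passes QF0 restricts_invy (or_introl (congr1 fst Ed)) pd.
Qed.

(** Both x and y have a pole at infinity and nowhere else, so only the corner point is met outside
    the affine part. *)
Lemma CP1xCP1_passes :
  passes_through D None ((xL K)^-1, (yL K)^-1) /\
  forall d s, CP1xCP1 d -> passes_through D s d ->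
    (exists a b, d = affine_point a b) \/ (d = ((xL K)^-1, (yL K)^-1) /\ s = None).
Proof.
split.
  exists (P%:F)^-1, (Q%:F)^-1; split=> /=.
  - exact: restricts_invx.
  - exact: restricts_invy.
  - by right; rewrite ordV; have := pole_None P1'; ord_lia.
  - by right; rewrite ordV; have := pole_None Q1; ord_lia.
move=> d s /CP1xCP1E[E|[b Ed]|[a Ed]|Ed] pd; first by left.
- have Es := inv_passes PF0 restricts_invx (or_introl (congr1 fst Ed)) pd.
  have [ru [rv [_]]] := pd; rewrite Ed Es /= => Rv _ vv.
  have Rv' := restrictsB (restricts_y D) (restricts_const D b).
  rewrite (restricts_unique Rv Rv') in vv.
  by have := ord_ge0_of_value vv; have := pole_None Q1; ord_lia.
- have Es := inv_passes QF0 restricts_invy (or_intror (congr1 snd Ed)) pd.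
  have [ru [rv [Ru _]]] := pd; rewrite Ed Es /= in Ru * => vu _.
  have Ru' := restrictsB (restricts_x D) (restricts_const D a).
  rewrite (restricts_unique Ru Ru') in vu.
  by have := ord_ge0_of_value vu; have := pole_None P1'; ord_lia.
- by right; split=> //; exact: inv_passes PF0 restricts_invx (or_introl (congr1 fst Ed)) pd.
Qed.

End PolynomialCurves.

(** * The affine part of the bicuspidal curves *)

(** A nonzero polynomial in t is t^i times a polynomial in t with nonzero constant term, and the
    latter is a unit at s. *)
Lemma transcendental_of_ord (K : fieldType) (s : P1 K) (t : ratfun1 K) (n : nat) :
  t != 0 -> ord s t = n.+1%:Z ->
  forall R : {poly K}, (map_poly (@const1 K) R).[t] = 0 -> R = 0.
Proof.
move=> t0 ot R; have [//|R0] := eqVneq R 0.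
have [i [d [-> d0]]] := poly_Xn_factor R0.
have d0' : (d%:P : {poly {poly K}})`_0`_0 != 0 by rewrite coefC.
have [ud _] := ord_ev2_unit ot ot (ltn0Sn n) (ltn0Sn n) d0'.
rewrite ev2_inner in ud.
rewrite rmorphM /= map_polyXn hornerM hornerXn => /eqP.
by rewrite mulf_eq0 expf_eq0 (negPf t0) andbF (negPf ud).
Qed.

Lemma coef1_XaddC_exp (K : fieldType) (c : K) n : (('X + c%:P) ^+ n)`_1 = c ^+ n.-1 *+ n.
Proof.
have := coef_deriv (('X + c%:P) ^+ n) 0; rewrite mulr1n => <-.
rewrite deriv_exp derivD derivX derivC addr0 mul1r coefMn -horner_coef0.
by rewrite horner_exp hornerD hornerX hornerC add0r.
Qed.

Section AffinePart.
Variables (K : fieldType) (p q alpha : nat) (k : K).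
Hypothesis char0 : forall n, n.+1%:R != 0 :> K.
Hypotheses (p1 : (1 < p)%N) (pq : (p < q)%N) (cpq : coprime p q).
Hypotheses (alpha1 : (1 < alpha)%N) (q_alpha : (q < alpha * p)%N).

Local Notation P := ('X^p : {poly K}).
Local Notation Q := ('X^q + k%:P * 'X^(alpha * p) : {poly K}).
Local Notation t := ('X%:F : ratfun1 K).

(* The curve of part (1) is the case k = 0, that of part (2) the case k = 1. *)
Definition bicuspidal : curve K := (P%:F, Q%:F).
Local Notation D := bicuspidal.

(** On the curve x = z^p and y - k x^alpha = z^q. *)
Definition bicuspidal_eq : {poly {poly K}} :=
  ('Y - const11 k * 'X^alpha) ^+ p - 'X^q.
Local Notation F := bicuspidal_eq.

Let p0 : (0 < p)%N. Proof. exact: ltnW. Qed.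
Let q0 : (0 < q)%N. Proof. exact: ltn_trans pq. Qed.
Let alpha0 : (0 < alpha)%N. Proof. exact: ltnW. Qed.

Let t0 : t != 0.
Proof. by rewrite tofrac_eq0 polyX_eq0. Qed.

Lemma bicuspidal1 : D.1 = t ^+ p.
Proof. by rewrite /= tofracXn. Qed.

Lemma bicuspidal2 : D.2 = t ^+ q + const1 k * t ^+ (alpha * p).
Proof. by rewrite /= tofracD tofracM !tofracXn. Qed.

(** The curve is the image of the monomial curve (z^p, z^q) under the plane automorphism (x, y + k
    x^alpha). *)
Lemma gen_bicuspidal : gen (@const1 K) D.1 D.2 F.
Proof.
have ot : ord (Some 0) t = 1%:Z by rewrite ord_X_Some eqxx.
have cqp : coprime q p by rewrite coprime_sym.
have tr := transcendental_of_ord t0 ot.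
have G := gen_swap (gen_monomial tr q0 p0 cqp).
set f := swapXY _ in G.
have Ef : f = 'Y ^+ p - 'X^q.
  have E1 : swapXY 'X^p = 'Y ^+ p :> {poly {poly K}} by rewrite rmorphXn /= swapXY_X.
  have E2 : swapXY ('Y ^+ q) = 'X^q :> {poly {poly K}} by rewrite rmorphXn /= swapXY_Y.
  rewrite /f -E1 -E2; exact: raddfB.
set w := const11 k * 'X^alpha.
have sw : sub2 'X ('Y - w) w = w.
  have E1 : sub2 'X ('Y - w) (const11 k) = const11 k by exact: ev2C.
  by rewrite {2}/w ev2M ev2Xn E1.
have evw : ev2 (@const1 K) D.1 D.2 w = const1 k * t ^+ (alpha * p).
  by rewrite /w ev2M ev2Xn ev2C bicuspidal1 -exprM mulnC.
have -> : F = sub2 'X ('Y - w) f.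
  have E1 : sub2 'X ('Y - w) ('Y ^+ p) = ('Y - w) ^+ p by exact: ev2Yn.
  by rewrite Ef ev2B E1 ev2Xn.
apply: (gen_auto (a' := 'X) (b' := 'Y + w) G).
- by rewrite ev2X bicuspidal1.
- by rewrite ev2B evw (ev2Y (@const1 K) D.1 D.2) bicuspidal2 addrK.
- by rewrite ev2X.
- have E1 : sub2 'X ('Y - w) 'Y = 'Y - w by exact: ev2Y.
  by rewrite ev2D E1 sw subrK.
Qed.

(* U has weight p and V has weight q. *)
Definition weight_ge c (f : {poly {poly K}}) :=
  forall i j, (i * p + j * q < c)%N -> f`_i`_j = 0.

Lemma weight_geM c d f g : weight_ge c f -> weight_ge d g -> weight_ge (c + d) (f * g).
Proof.
move=> Wf Wg i j H; rewrite coefM coef_sum; apply: big1 => l _.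
rewrite coefM; apply: big1 => r _.
have := ltn_ord l; have := ltn_ord r; rewrite !ltnS => rj li.
have [lt|ge] := ltnP (l * p + r * q) c; first by rewrite Wf // mul0r.
rewrite (Wg (i - l)%N (j - r)%N) ?mulr0 // !mulnBl.
have : (l * p <= i * p)%N by rewrite leq_mul2r li orbT.
have : (r * q <= j * q)%N by rewrite leq_mul2r rj orbT.
by move: H ge; move: (l * p)%N (i * p)%N (r * q)%N (j * q)%N => *; lia.
Qed.

Lemma weight_geX c f n : weight_ge c f -> weight_ge (n * c) (f ^+ n).
Proof.
move=> W; elim: n => [|n IH]; first by move=> i j; rewrite mul0n ltn0.
by rewrite exprS mulSn; exact: weight_geM.
Qed.

(** Since alpha p > q, the term k U^alpha has larger weight than V. So all monomials have weight at
    least p q, and the ends V^p and U^q keep the coefficients 1 and -1. *)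
Lemma newton_edge_bicuspidal : newton_edge p q F.
Proof.
have W0 : weight_ge q ('Y - const11 k * 'X^alpha).
  move=> i j H; rewrite mulrC !coefB coef_XnM /const11 !coefC.
  have -> : ((if i == 0 then 'X else 0) : {poly K})`_j = 0.
    have [Ei|_] := eqVneq i 0%N; last by rewrite coef0.
    rewrite coefX; case: eqVneq => // Ej.
    by move: H; rewrite Ei Ej; lia.
  rewrite sub0r; case: ltnP => le; first by rewrite oppr0.
  by have : (alpha * p <= i * p)%N by [rewrite leq_mul2r le orbT]; lia.
have W := weight_geX (n := p) W0.
split=> [||i j H].
- rewrite -horner_coef0 /F hornerD hornerN !horner_exp hornerD hornerN hornerM !horner_exp.
  rewrite !hornerC !hornerX !expr0n !eqn0Ngt q0 alpha0 mulr0 !subr0 coefXn eqxx.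
  exact: oner_neq0.
- rewrite -coef_swapXY -horner_coef0.
  have -> : swapXY F = ('X - const11 k * 'Y ^+ alpha) ^+ p - 'Y ^+ q.
    apply: sub2_inj_eq; rewrite ev2_swapXY /F !ev2B !ev2_exp !ev2B !ev2M !ev2_exp.
    by rewrite !(ev2X (@const2 K)) !(ev2Y (@const2 K)) !ev2C.
  rewrite hornerD hornerN horner_exp hornerD hornerN hornerM !horner_exp !hornerC hornerX.
  rewrite sub0r coefB coefXn eqxx exprNn exprMn -exprM mulrA.
  rewrite coefMXn q_alpha sub0r oppr_eq0; exact: oner_neq0.
have Hq : (j == 0)%N && (i == q) = false.
  by apply/negP => /andP[/eqP Ej /eqP Ei]; move: H; rewrite Ei Ej; lia.
rewrite /F !coefB W // sub0r coefXn.
case: (eqVneq i q) Hq => [_|_ _]; last by rewrite mulr0n coef0 oppr0.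
by rewrite andbT mulr1n coef1 => ->; rewrite oppr0.
Qed.

Lemma bicuspidal_eq_neq0 : F != 0.
Proof.
by have [H _ _] := newton_edge_bicuspidal; apply: contra_neq H => ->; rewrite !coef0.
Qed.

Lemma bicuspidal_base : equation_in_L D (base_chart K) != 0.
Proof.
have [c c0 ->] := equation_baseE gen_bicuspidal.
by rewrite mulf_neq0 ?tofrac_eq0 ?bicuspidal_eq_neq0 // !polyC_eq0.
Qed.

Lemma ord_bicuspidal1 : ord (Some 0) D.1 = p%:Z.
Proof. by rewrite bicuspidal1 ordX ord_X_Some eqxx mulr1. Qed.

Lemma bicuspidal1_neq0 : D.1 != 0.
Proof. by rewrite bicuspidal1 expf_neq0. Qed.

Lemma bicuspidal2_spec : D.2 != 0 /\ ord (Some 0) D.2 = q%:Z.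
Proof.
have tq0 := expf_neq0 q t0.
have oq : ord (Some 0) (t ^+ q) = q%:Z by rewrite ordX ord_X_Some eqxx mulr1.
rewrite bicuspidal2 -oq; apply: ordD_lt tq0 _ => n.
have ta0 := expf_neq0 (alpha * p) t0.
have k0 : const1 k != 0 by apply: contra_neq n => ->; rewrite mul0r.
by rewrite (ordM _ k0 ta0) ord_const add0r oq ordX ord_X_Some eqxx mulr1 ltz_nat.
Qed.

Lemma germ_bicuspidal : germ D (Some 0) (affine_point 0 0) p q 0.
Proof.
have := local_eq_affine (Some 0) 0 0 gen_bicuspidal.
rewrite (_ : const11 0 = 0); last by rewrite /const11 !polyC0.
rewrite (_ : const1 0 = 0); last by rewrite /const1 polyC0 tofrac0.
rewrite !subr0 !addr0 sub2_id => Lf.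
have [D20 o2] := bicuspidal2_spec.
exists D.1, D.2, F; split; [exact: Lf | | exact: ord_bicuspidal1 | exact: o2 |].
  by split; [exact: bicuspidal1_neq0 | exact: D20].
exact: newton_edge_bicuspidal.
Qed.

Lemma sizeP_gt1 : (1 < size P)%N.
Proof. by rewrite size_polyXn ltnS. Qed.

Lemma sizeQ_gt : (size P < size Q)%N.
Proof.
have Qq : Q`_q != 0.
  by rewrite coefD coefXn eqxx coefCM coefXn ltn_eqF // mulr0 addr0 oner_neq0.
rewrite size_polyXn; apply: leq_ltn_trans pq _; rewrite ltnNge.
by apply: contra Qq => /leq_sizeP ->.
Qed.

(** After translation to the point, the coefficient of V is p z^(q (p - 1)), nonzero for z nonzero
    in characteristic 0. *)
Lemma regular_affine X z : z != 0 -> point_at X D (Some z) = affine_point P.[z] Q.[z] ->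
  smooth_at X D (Some z) /\ local_degree D X (Some z) = 0.
Proof.
move=> z0 Ec; have Lf := local_eq_affine (Some z) P.[z] Q.[z] gen_bicuspidal.
split; last exact: local_degree_eq bicuspidal_base Ec Lf.
apply/(smooth_atE Ec Lf); right; set A := const11 P.[z]; set B := const11 Q.[z].
have -> : sub2 ('X + A) ('Y + B) F =
    (('Y + B) - const11 k * ('X + A) ^+ alpha) ^+ p - ('X + A) ^+ q.
  have E1 : sub2 ('X + A) ('Y + B) (const11 k) = const11 k by exact: ev2C.
  have E2 : sub2 ('X + A) ('Y + B) 'Y = 'Y + B by exact: ev2Y.
  by rewrite /F ev2B ev2_exp ev2B ev2M !ev2Xn E1 E2.
rewrite -horner_coef0 hornerD hornerN !horner_exp hornerD hornerN hornerM !hornerD !horner_exp.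
rewrite !hornerD !hornerX /A /B /const11 !hornerC !add0r -!polyC_exp -polyCM -addrA -polyCB.
have Pz : P.[z] = z ^+ p by exact: hornerXn.
have Qz : Q.[z] = z ^+ q + k * z ^+ (alpha * p) by rewrite hornerD hornerM hornerC !hornerXn.
rewrite Pz Qz -exprM [(p * alpha)%N]mulnC addrK.
rewrite coefB coefC subr0 coef1_XaddC_exp -mulr_natr mulf_neq0 ?expf_neq0 //.
by case: p p0 => // n _.
Qed.
Lemma puiseux_bicuspidal X : point_at X D (Some 0) = affine_point 0 0 ->
  puiseux_pair X D (Some 0) = (p, q).
Proof.
rewrite /affine_point (_ : const2 0 = 0) ?subr0; last by rewrite /const2 !polyC0 tofrac0.
move=> Ec; have tq0 := expf_neq0 q t0.
have E : D.2 = t ^+ q + const1 k * D.1 ^+ alpha.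
  by rewrite bicuspidal2 bicuspidal1 -exprM [(p * alpha)%N]mulnC.
apply: (puiseux_pair_shear Ec (restricts_x D) (restricts_y D) alpha1 E bicuspidal1_neq0 tq0).
- exact: ord_bicuspidal1.
- by rewrite ordX ord_X_Some eqxx mulr1.
- by rewrite p1 pq.
- exact: cpq.
Qed.
End AffinePart.

(** * The points at infinity *)

(** Gives the factor by which the equation at [0 : 1 : 0] differs from the affine one, as [local_eq]
    requires. *)
Lemma infty_CP2_identity (L : fieldType) (x y : L) p q : y != 0 -> (p <= q)%N ->
  (y^-1) ^+ (q - p) - (x / y) ^+ q = (y^-1) ^+ q * (y ^+ p - x ^+ q).
Proof.
move=> y0 pq; rewrite exprMn mulrBr [x ^+ q * _]mulrC; congr (_ - _).
have E : (y^-1) ^+ q = (y^-1) ^+ (q - p) * (y^-1) ^+ p by rewrite -exprD subnK.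
by rewrite E -mulrA -exprMn mulVf // expr1n mulr1.
Qed.

Lemma infty_CP1xCP1_identity (L : fieldType) (x y : L) p q alpha : x != 0 -> y != 0 ->
  (q <= alpha * p)%N ->
  ((x^-1) ^+ alpha - y^-1) ^+ p - (y^-1) ^+ p * (x^-1) ^+ (alpha * p - q) =
  (x^-1) ^+ (alpha * p) * (y^-1) ^+ p * ((y - x ^+ alpha) ^+ p - x ^+ q).
Proof.
move=> x0 y0 le.
have E1 : (x^-1) ^+ alpha - y^-1 = (x^-1) ^+ alpha * y^-1 * (y - x ^+ alpha).
  by rewrite mulrBr -mulrA mulVf // mulr1 mulrAC -exprMn mulVf // expr1n mul1r.
have E2 : (x^-1) ^+ (alpha * p) * x ^+ q = (x^-1) ^+ (alpha * p - q).
  by rewrite -{1}(subnK le) exprD -mulrA -exprMn mulVf // expr1n mulr1.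
by rewrite E1 !exprMn -exprM mulrBr; congr (_ - _); rewrite mulrAC E2 mulrC.
Qed.

Lemma reversalx_identity (L : fieldType) (x y : L) p q alpha : x != 0 ->
  (q <= alpha * p)%N ->
  x ^+ (alpha * p) * ((y - (x^-1) ^+ alpha) ^+ p - (x^-1) ^+ q) =
  (y * x ^+ alpha - 1) ^+ p - x ^+ (alpha * p - q).
Proof.
move=> x0 le; rewrite mulrBr {1}exprM -exprMn; congr (_ ^+ _ - _).
  by rewrite mulrBr -exprMn divff // expr1n mulrC.
by rewrite -{1}(subnK le) exprD -mulrA -exprMn divff // expr1n mulr1.
Qed.

Lemma reversaly_identity (L : fieldType) (y z w : L) p : y != 0 ->
  y ^+ p * ((y^-1 * z - 1) ^+ p - w) = (z - y) ^+ p - y ^+ p * w.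
Proof. by move=> y0; rewrite mulrBr -exprMn mulrBr mulr1 mulrA divff // mul1r. Qed.

Lemma expV_sub (L : fieldType) (x : L) p q : x != 0 -> (p <= q)%N ->
  (x^-1) ^+ (q - p) = x ^+ p / x ^+ q.
Proof.
move=> x0 pq; apply: (canRL (mulfK (expf_neq0 q x0))).
by rewrite -{2}(subnK pq) exprD mulrA -exprMn mulVf // expr1n mul1r.
Qed.

Lemma invD_identity (L : fieldType) (a b : L) : b != 0 -> a + b != 0 ->
  (a + b)^-1 = - (a / (b * (a + b))) + b^-1.
Proof.
by move=> b0 ab0; field; rewrite b0 ab0.
Qed.

Lemma ev2_bicuspidal_eq (K : fieldType) (E : comNzRingType) (iota : {rmorphism K -> E})
    (u v : E) p q alpha (k : K) :
  ev2 iota u v (bicuspidal_eq p q alpha k) = (v - iota k * u ^+ alpha) ^+ p - u ^+ q.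
Proof. by rewrite ev2B ev2_exp ev2B ev2M !ev2Xn ev2C (ev2Y iota u). Qed.

Lemma bicuspidal_eqF (K : fieldType) p q alpha (k : K) :
  (bicuspidal_eq p q alpha k)%:F =
    (yL K - const2 k * xL K ^+ alpha) ^+ p - xL K ^+ q.
Proof. by rewrite -[LHS]ev2_tofrac; exact: (ev2_bicuspidal_eq (@const2 K)). Qed.

Lemma coprime_sub p q : (p < q)%N -> coprime p q -> coprime q (q - p).
Proof.
move=> pq; rewrite /coprime => cpq.
by rewrite -{1}(subnK (ltnW pq)) gcdnC gcdnDl gcdnC -(gcdnDr p) subnK // ltnW.
Qed.

Section InfinityCP2.
Variables (K : fieldType) (p q alpha : nat).
Hypotheses (p1 : (1 < p)%N) (pq : (p < q)%N) (cpq : coprime p q).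
Local Notation t := ('X%:F : ratfun1 K).
Local Notation D := (bicuspidal p q alpha (0 : K)).

Let t0 : t != 0. Proof. by rewrite tofrac_eq0 polyX_eq0. Qed.

Lemma bicuspidal2_k0 : D.2 = t ^+ q.
Proof. by rewrite bicuspidal2 /const1 polyC0 tofrac0 mul0r addr0. Qed.

Lemma infty_CP2_coords :
  restricts D (yL K)^-1 (t^-1 ^+ q) /\ restricts D (xL K / yL K) (t^-1 ^+ (q - p)).
Proof.
have tq0 := expf_neq0 q t0.
have D20 : D.2 != 0 by rewrite bicuspidal2_k0.
split; first by rewrite exprVn -bicuspidal2_k0; exact: restrictsV (restricts_y D) D20.
have -> : t^-1 ^+ (q - p) = D.1 / D.2; last first.
  exact: restricts_div (restricts_x D) (restricts_y D) D20.
rewrite bicuspidal1 bicuspidal2_k0; exact: (expV_sub t0 (ltnW pq)).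
Qed.

Lemma ord_infty n : ord None (t^-1 ^+ n) = n%:Z.
Proof. by rewrite ordX ordV ord_X_None opprK mulr1. Qed.

(** The factor between the two equations is y^(-q), of order q * q at infinity. This is all of D . D
    for a plane curve of degree q. *)
Lemma germ_CP2_infty : germ D None ((yL K)^-1, xL K / yL K) q (q - p) (q * q)%:Z.
Proof.
have p0 : (0 < p)%N := ltnW p1.
have q0 : (0 < q)%N := ltn_trans p0 pq.
have qp0 : (0 < q - p)%N by rewrite subn_gt0.
have tV0 := invr_neq0 t0.
have otV : ord None t^-1 = 1%:Z by rewrite ordV ord_X_None opprK.
have cqp := coprime_sub pq cpq.
have G := gen_monomial (transcendental_of_ord tV0 otV) q0 qp0 cqp.
have GF := gen_bicuspidal alpha (0 : K) p1 pq cpq.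
have [Ru Rv] := infty_CP2_coords.
have y0 : yL K != 0 by rewrite tofrac_eq0 polyC_eq0 polyX_eq0.
have Ew : ev2 (@const2 K) (yL K)^-1 (xL K / yL K) ('X^(q - p) - 'Y ^+ q) =
    ((yL K)^-1) ^+ q * (bicuspidal_eq p q alpha (0 : K))%:F.
  rewrite ev2B ev2Xn ev2Yn bicuspidal_eqF (_ : const2 0 = 0).
    by rewrite mul0r subr0; exact: infty_CP2_identity y0 (ltnW pq).
  by rewrite /const2 !polyC0 tofrac0.
have Rw := restrictsX q Ru.
have tq0 := expf_neq0 q tV0.
have Lf : local_eq D None ((yL K)^-1, xL K / yL K) (t^-1 ^+ q) (t^-1 ^+ (q - p))
    ('X^(q - p) - 'Y ^+ q) (q * q)%:Z.
  apply: (local_eq_intro (c := ((yL K)^-1, xL K / yL K)) GF Ru Rv G Ew Rw (expf_neq0 q tq0)).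
  by rewrite ordX ord_infty PoszM.
exists (t^-1 ^+ q), (t^-1 ^+ (q - p)), ('X^(q - p) - 'Y ^+ q).
split; [exact: Lf | | exact: ord_infty | exact: ord_infty |].
  by split; [exact: tq0 | exact: (expf_neq0 (q - p) tV0)].
have -> : 'X^(q - p) - 'Y ^+ q = 'Y ^+ q * (-1) + 'X^(q - p) * 1 :> {poly {poly K}}.
  by rewrite mulrN1 mulr1 addrC.
apply: newton_edge_binomial => //; last by rewrite coefC coefC oner_eq0.
by rewrite coefN coefN coefC coefC oppr_eq0 oner_eq0.
Qed.

Lemma puiseux_CP2_infty X : (1 < q - p)%N -> point_at X D None = ((yL K)^-1, xL K / yL K) ->
  puiseux_pair X D None = ((q - p)%N, q).
Proof.
move=> qp1 Ec; have [Ru Rv] := infty_CP2_coords.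
have tV0 := invr_neq0 t0.
apply: (puiseux_pair_swap Ec Ru Rv (expf_neq0 _ tV0) (expf_neq0 _ tV0)).
- exact: ord_infty.
- exact: ord_infty.
- by rewrite qp1 /=; lia.
- by rewrite coprime_sym; exact: coprime_sub.
Qed.
End InfinityCP2.

Lemma coprime_subMr p q n : coprime p q -> (q <= n * p)%N -> coprime p (n * p - q).
Proof.
move=> cpq le; rewrite /coprime -dvdn1 -(eqP cpq) dvdn_gcd dvdn_gcdl /=.
have H : (gcdn p (n * p - q) %| n * p)%N by apply: dvdn_mull; exact: dvdn_gcdl.
by rewrite -(dvdn_subr le H) dvdn_gcdr.
Qed.

Section InfinityCP1xCP1.
Variables (K : fieldType) (p q alpha : nat).
Hypotheses (p1 : (1 < p)%N) (pq : (p < q)%N) (cpq : coprime p q).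
Hypotheses (q_alpha : (q < alpha * p)%N).
Local Notation t := ('X%:F : ratfun1 K).
Local Notation D := (bicuspidal p q alpha (1 : K)).
Local Notation e := (alpha * p - q)%N.

Let t0 : t != 0. Proof. by rewrite tofrac_eq0 polyX_eq0. Qed.
Let p0 : (0 < p)%N. Proof. exact: ltnW. Qed.
Let alpha0 : (0 < alpha)%N. Proof. by move: q_alpha; case: alpha. Qed.

Lemma const1_1 : const1 1 = 1 :> ratfun1 K.
Proof. by rewrite /const1 polyC1 tofrac1. Qed.

Lemma const11_1 : const11 1 = 1 :> {poly {poly K}}.
Proof. by rewrite /const11 polyC1. Qed.

Lemma ord_None_t n : ord None (t ^+ n) = - n%:Z.
Proof. by rewrite ordX ord_X_None mulrN1. Qed.

Lemma bicuspidal2_infty : D.2 != 0 /\ ord None D.2 = - (alpha * p)%:Z.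
Proof.
have ta0 := expf_neq0 (alpha * p) t0.
rewrite bicuspidal2 const1_1 mul1r addrC -ord_None_t; apply: ordD_lt ta0 _ => _.
by rewrite !ord_None_t; lia.
Qed.

Lemma size_bicuspidal_eq : size (bicuspidal_eq p q alpha (1 : K)) = (alpha * p).+1.
Proof.
have s1 : size ('Y - const11 1 * 'X^alpha : {poly {poly K}}) = alpha.+1.
  by rewrite const11_1 mul1r -opprB size_polyN size_XnsubC.
have b0 : 'Y - const11 1 * 'X^alpha != 0 :> {poly {poly K}}.
  by rewrite -size_poly_gt0 s1.
have s2 : size (('Y - const11 1 * 'X^alpha : {poly {poly K}}) ^+ p) = (alpha * p).+1.
  have := size_exp ('Y - const11 1 * 'X^alpha : {poly {poly K}}) p; rewrite s1 /= => <-.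
  by rewrite prednK // size_poly_gt0 expf_neq0.
by rewrite /bicuspidal_eq size_polyDl // size_polyN size_polyXn s2 ltnS.
Qed.

(** Reversal inverts the outer variable only. So x is inverted, the variables are exchanged, y is
    inverted, and the variables are exchanged back, passing through f1, f2 and f3. *)
Lemma gen_CP1xCP1_infty : gen (@const1 K) D.1^-1 D.2^-1 (tangency K p e alpha).
Proof.
have le := ltnW q_alpha.
have D10 := bicuspidal1_neq0 p q alpha (1 : K).
have [D20 _] := bicuspidal2_infty.
have x0 : xL K != 0 by rewrite tofrac_eq0 polyX_eq0.
have y0 : yL K != 0 by rewrite tofrac_eq0 polyC_eq0 polyX_eq0.
have G := gen_bicuspidal alpha (1 : K) p1 pq cpq.
have G1 := gen_inv G D10 size_bicuspidal_eq.
have c2 : const2 1 = 1 :> ratfun2 K by rewrite /const2 !polyC1 tofrac1.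
pose f1 : {poly {poly K}} := ('Y * 'X^alpha - 1) ^+ p - 'X^e.
have E1 : rev_poly (alpha * p) (bicuspidal_eq p q alpha 1) = f1.
  apply: sub2_inj_eq.
  rewrite (ev2_rev (@const2 K) (yL K) x0 (eq_leq size_bicuspidal_eq)).
  have -> : ev2 (@const2 K) (xL K)^-1 (yL K) (bicuspidal_eq p q alpha 1) =
      (yL K - (xL K)^-1 ^+ alpha) ^+ p - (xL K)^-1 ^+ q.
    by rewrite (ev2_bicuspidal_eq (@const2 K)) /= c2 mul1r.
  rewrite (reversalx_identity _ x0 le).
  by rewrite ev2B ev2_exp ev2B ev2M !ev2Xn ev2_1 (ev2Y (@const2 K) (xL K)).
rewrite E1 in G1; have {G1}G2 := gen_swap G1.
pose f2 : {poly {poly K}} := ('X * 'Y ^+ alpha - 1) ^+ p - 'Y ^+ e.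
have E2 : swapXY f1 = f2.
  apply: sub2_inj_eq; rewrite ev2_swapXY.
  by rewrite !ev2B !ev2_exp !ev2B !ev2M !ev2_1 !ev2_exp !(ev2X (@const2 K)) !(ev2Y (@const2 K)).
rewrite E2 in G2.
have s2 : size f2 = p.+1.
  have s1 : size ('X * 'Y ^+ alpha - 1 : {poly {poly K}}) = 2.
    have -> : 'X * 'Y ^+ alpha - 1 = ('X^alpha)%:P * 'X + (-1)%:P :> {poly {poly K}}.
      by rewrite mulrC polyC_exp polyCN polyC1.
    have Xa : 'X^alpha != 0 :> {poly K} by rewrite expf_neq0 // polyX_eq0.
    by rewrite size_MXaddC polyC_eq0 (negPf Xa) size_polyC Xa.
  have b0 : 'X * 'Y ^+ alpha - 1 != 0 :> {poly {poly K}} by rewrite -size_poly_gt0 s1.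
  have s3 : size (('X * 'Y ^+ alpha - 1 : {poly {poly K}}) ^+ p) = p.+1.
    have E := size_exp ('X * 'Y ^+ alpha - 1 : {poly {poly K}}) p; rewrite s1 mul1n in E.
    have gt0 : (0 < size (('X * 'Y ^+ alpha - 1 : {poly {poly K}}) ^+ p))%N.
      by rewrite size_poly_gt0 (expf_neq0 p b0).
    by rewrite -[LHS](prednK gt0) E.
  rewrite /f2 size_polyDl // size_polyN s3 -polyC_exp.
  by apply: leq_ltn_trans (size_polyC_leq1 _) _; rewrite ltnS.
have {G2}G3 := gen_inv G2 D20 s2.
pose f3 : {poly {poly K}} := ('Y ^+ alpha - 'X) ^+ p - 'X^p * 'Y ^+ e.
have E3 : rev_poly p f2 = f3.
  apply: sub2_inj_eq; rewrite (ev2_rev (@const2 K) (yL K) x0 (eq_leq s2)).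
  have -> : ev2 (@const2 K) (xL K)^-1 (yL K) f2 =
      ((xL K)^-1 * yL K ^+ alpha - 1) ^+ p - yL K ^+ e.
    by rewrite ev2B ev2_exp ev2B ev2M !ev2Yn ev2_1 (ev2X (@const2 K) (xL K)^-1).
  rewrite (reversaly_identity _ _ _ x0).
  by rewrite ev2B ev2_exp ev2B ev2M ev2Xn !ev2Yn (ev2X (@const2 K) (xL K)).
rewrite E3 in G3; have {G3}G4 := gen_swap G3.
have E4 : swapXY f3 = tangency K p e alpha; last by rewrite -E4.
apply: sub2_inj_eq; rewrite ev2_swapXY /f3 /tangency.
by rewrite !ev2B !ev2_exp !ev2B !ev2M !ev2_exp !(ev2X (@const2 K)) !(ev2Y (@const2 K)).
Qed.

Lemma ord_D1_infty : ord None D.1 = - p%:Z.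
Proof. by rewrite bicuspidal1 ord_None_t. Qed.

(** The factor between the two equations is x^(- alpha p) y^(- p), and each of its two powers has
    order alpha p^2 at infinity. The sum is the self-intersection of a curve whose projections have
    degrees p and alpha p. *)
Lemma tangent_germ_infty :
  tangent_germ D None p e ((xL K)^-1, (yL K)^-1) alpha (2 * (alpha * p * p))%:Z.
Proof.
have le := ltnW q_alpha.
have D10 := bicuspidal1_neq0 p q alpha (1 : K).
have [D20 oD2] := bicuspidal2_infty.
have x0 : xL K != 0 by rewrite tofrac_eq0 polyX_eq0.
have y0 : yL K != 0 by rewrite tofrac_eq0 polyC_eq0 polyX_eq0.
have Ru := restrictsV (restricts_x D) D10.
have Rv := restrictsV (restricts_y D) D20.
have c2 : const2 1 = 1 :> ratfun2 K by rewrite /const2 !polyC1 tofrac1.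
have Ew : ev2 (@const2 K) (xL K)^-1 (yL K)^-1 (tangency K p e alpha) =
    ((xL K)^-1 ^+ (alpha * p) * (yL K)^-1 ^+ p) * (bicuspidal_eq p q alpha (1 : K))%:F.
  rewrite bicuspidal_eqF c2 mul1r -(infty_CP1xCP1_identity x0 y0 le).
  by rewrite ev2B ev2_exp ev2B ev2M !ev2Xn ev2Yn (ev2Y (@const2 K) (xL K)^-1).
have Rw := restrictsM (restrictsX (alpha * p) Ru) (restrictsX p Rv).
have iD10 := expf_neq0 (alpha * p) (invr_neq0 D10).
have iD20 := expf_neq0 p (invr_neq0 D20).
exists D.1^-1, D.2^-1; split.
- apply: (local_eq_intro (c := ((xL K)^-1, (yL K)^-1)) (gen_bicuspidal alpha (1 : K) p1 pq cpq)
    Ru Rv gen_CP1xCP1_infty Ew Rw (mulf_neq0 iD10 iD20)).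
  by rewrite (ordM None iD10 iD20) !ordX !ordV oD2 ord_D1_infty; lia.
- by split; [exact: (invr_neq0 D10) | exact: (invr_neq0 D20)].
- by rewrite ordV ord_D1_infty opprK.
- by rewrite ordV oD2 opprK.
Qed.

Lemma puiseux_CP1xCP1_infty X : (1 < alpha)%N ->
  point_at X D None = ((xL K)^-1, (yL K)^-1) ->
  puiseux_pair X D None = (p, (2 * alpha * p - q)%N).
Proof.
move=> alpha1 Ec.
have D10 := bicuspidal1_neq0 p q alpha (1 : K).
have [D20 oD2] := bicuspidal2_infty.
have Ru := restrictsV (restricts_x D) D10.
have Rv := restrictsV (restricts_y D) D20.
have tq0 := expf_neq0 q t0; have ta0 := expf_neq0 (alpha * p) t0.
have tD0 := mulf_neq0 ta0 D20.
(* The functions 1 / y and x^(- alpha) have the same leading term at infinity; rh is their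
   difference (x^alpha - y) / (x^alpha y), of order 2 alpha p - q. *)
pose rh := - (t ^+ q / (t ^+ (alpha * p) * D.2)).
have E : D.2^-1 = rh + const1 1 * D.1^-1 ^+ alpha.
  rewrite const1_1 mul1r exprVn bicuspidal1 -exprM [(p * alpha)%N]mulnC /rh.
  have ED : D.2 = t ^+ q + t ^+ (alpha * p) by rewrite bicuspidal2 const1_1 mul1r.
  move: D20; rewrite ED; exact: (invD_identity ta0).
have q0 := divf_neq0 tq0 tD0.
have rh0 : rh != 0 by rewrite oppr_eq0.
apply: (puiseux_pair_shear Ec Ru Rv alpha1 E (invr_neq0 D10) rh0).
- by rewrite ordV ord_D1_infty opprK.
- rewrite ordN (ordM None tq0 (invr_neq0 tD0)) ordV (ordM None ta0 D20) oD2 !ord_None_t.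
  by move: q_alpha; rewrite -mulnA; move: (alpha * p)%N => m'; lia.
- rewrite p1 /= -mulnA; move: pq q_alpha; move: (alpha * p)%N => m'; lia.
have le : (q <= 2 * alpha * p)%N by rewrite -mulnA; move: q_alpha; move: (alpha * p)%N => m'; lia.
exact: coprime_subMr.
Qed.
End InfinityCP1xCP1.

(** * The gaps *)

Section Gaps.
Variable K : fieldType.
Hypothesis char0 : forall n, n.+1%:R != 0 :> K.

Section CP2.
Variables p q : nat.
Hypotheses (p1 : (1 < p)%N) (pq : (p < q)%N) (cpq : coprime p q) (qp1 : (1 < q - p)%N).
Let X : surface K := CP2 (K := K).
(** The value q for alpha meets 1 < alpha and q < alpha p, as the lemmas on the affine part ask. *)
Let D : curve K := bicuspidal p q q 0.

Lemma curve1E : curve1 K p q = D.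
Proof. by rewrite /curve1 /D /bicuspidal polyC0 mul0r addr0. Qed.

(** The products cancel by p q + (q - p) q = q^2. Both cusps reduce to (p, q - p) in one Euclidean
    step, so they share r. Only the corrections of [m_euclid] survive, and the one for consecutive
    exponents is excluded by p > 1 and q - p > 1. *)
Lemma gap_CP2 :
  gap (resolve X (curve1 K p q) (Some 0)) (curve1 K p q) =
    ((2 < q - p)%N && (q - p %| q + 1)%N)%:Z /\
  gap (resolve X (curve1 K p q) None) (curve1 K p q) = ((2 < p)%N && (p %| q + 1)%N)%:Z.
Proof.
rewrite curve1E.
have p0 : (0 < p)%N := ltnW p1.
have q0 : (0 < q)%N := ltn_trans p0 pq.
have q1 : (1 < q)%N := ltn_trans p1 pq.
have qp0 : (0 < q - p)%N := ltnW qp1.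
have qlt : (q < q * p)%N by rewrite ltn_Pmulr.
have sP := sizeP_gt1 K p1.
have sPQ := sizeQ_gt (0 : K) pq qlt.
have sQ := ltn_trans sP sPQ.
have [cN Xp] := CP2_passes sP sQ sPQ.
have Xa a b : X (affine_point a b) by apply/CP2E; constructor 1; exists a, b.
have Xi : X ((yL K)^-1, xL K / yL K) by apply/CP2E; constructor 3.
have X1 : one_point D X := one_point_polynomial sP sQ Xa Xi cN Xp.
have Ez z : point_at X D (Some z) = _ := point_at_affine sP sQ Xa Xi cN Xp z.
have EN : point_at X D None = _ := point_at_None sP sQ Xa Xi cN Xp.
have iN : isolated D X None := isolated_None sP sQ Xa Xi cN Xp.
have i0 : isolated D X (Some 0).
  apply: (isolated_Some sP sQ Xa Xi cN Xp) => z; rewrite !hornerXn expr0n eqn0Ngt p0 /=.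
  by move/eqP; rewrite expf_eq0 p0 => /eqP.
have reg z : z != 0 -> smooth_at X D (Some z) /\ local_degree D X (Some z) = 0.
  by move=> z0; exact: (regular_affine char0 p1 pq cpq q1 qlt z0 (Ez z)).
have E0 : point_at X D (Some 0) = affine_point 0 0.
  rewrite Ez; congr (affine_point _ _); first by rewrite hornerXn expr0n eqn0Ngt p0.
  rewrite hornerD hornerM hornerC !hornerXn mul0r addr0 expr0n eqn0Ngt q0.
  by [].
have b0 : equation_in_L D (base_chart K) != 0 := bicuspidal_base (0 : K) p1 pq cpq q1 qlt.
have g0 : germ D (Some 0) (affine_point 0 0) p q 0 := germ_bicuspidal (0 : K) p1 pq cpq q1 qlt.
have gN : germ D None _ q (q - p) (q * q)%:Z := germ_CP2_infty K q p1 pq cpq.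
have cpqp : coprime p (q - p) by rewrite /coprime -(gcdnDr p) subnK // ltnW.
have [r tl] := euclid_tail_ex p0 qp0 cpqp.
have tl0 : euclid_tail p q r by rewrite -(subnKC (ltnW pq)); constructor.
have tlN : euclid_tail (q - p) q r.
  by rewrite -{2}(subnK (ltnW pq)); constructor=> //; exact: euclid_tail_sym.
have R0 := germ_resolvable b0 tl0 p0 q0 X1 i0 E0 g0.
have RN := germ_resolvable b0 (euclid_tail_sym tlN) q0 qp0 X1 iN EN gN.
have nsm0 : ~ smooth_at X D (Some 0) by move/(germ_smooth p0 q0 E0 g0); lia.
have nsmN : ~ smooth_at X D None by move/(germ_smooth q0 qp0 EN gN); lia.
have d0 := germ_degree b0 E0 g0.
have dN := germ_degree b0 EN gN.
have ppN : puiseux_pair X D None = _ := puiseux_CP2_infty p1 pq cpq qp1 EN.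
have pp0 : puiseux_pair X D (Some 0) = (p, q).
  exact: puiseux_bicuspidal p1 pq cpq q1 _ E0.
have reg' s : s <> Some 0 -> s <> None -> smooth_at X D s /\ local_degree D X s = 0.
  case: s => [z|//] sz _; apply: reg; apply/eqP => z0; by rewrite z0 in sz.
split.
  rewrite (gap_resolve _ R0 nsmN dN ppN reg') //.
  have qpq : (q - p < q)%N by rewrite ltn_subrL p0.
  have cqpq : coprime (q - p) q by rewrite coprime_sym; exact: coprime_sub.
  rewrite (m_euclid qp1 qpq cqpq tlN).
  have -> : (q == q - p + 1)%N = false by apply/eqP; lia.
  move: (_ && _) => b; have := mulnBl q p q; move: (leq_mul (ltnW pq) (leqnn q)).
  by move: ((q - p) * q)%N (q * q)%N (p * q)%N => *; lia.
rewrite (gap_resolve _ RN nsm0 d0 pp0 (fun s a b => reg' s b a)) //.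
rewrite (m_euclid p1 pq cpq tl0).
have -> : (q == p + 1)%N = false by apply/eqP; lia.
move: (_ && _) => b; have := mulnBr q q p; move: (leq_mul (leqnn q) (ltnW pq)).
rewrite [(p * q)%N]mulnC.
by move: (q * (q - p))%N (q * q)%N (q * p)%N => *; lia.
Qed.
End CP2.

Section CP1xCP1.
Variables p q alpha : nat.
Hypotheses (p1 : (1 < p)%N) (pq : (p < q)%N) (cpq : coprime p q).
Hypotheses (q_alpha : (q < alpha * p)%N).
Let X : surface K := CP1xCP1 (K := K).
Let D : curve K := bicuspidal p q alpha 1.

Lemma curve2E : curve2 K p q alpha = D.
Proof. by rewrite /curve2 /D /bicuspidal polyC1 mul1r. Qed.

(** The products cancel by p q + p e = alpha p^2. What remains is the difference of r1 and r2 plus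
    the corrections of [m_euclid]. By [euclid_tail_opp] the condition that p divides q - 1,
    contributed by the cusp at infinity, turns into p dividing q + 1 in the gap, and conversely for
    the cusp at 0. *)
Lemma gap_CP1xCP1 :
  gap (resolve X (curve2 K p q alpha) (Some 0)) (curve2 K p q alpha) =
    ((2 < p)%N && (p %| q + 1)%N)%:Z /\
  gap (resolve X (curve2 K p q alpha) None) (curve2 K p q alpha) =
    ((2 < p)%N && (p %| q - 1)%N + (q == p + 1)%N)%N%:Z.
Proof.
rewrite curve2E.
have p0 : (0 < p)%N := ltnW p1.
have q0 : (0 < q)%N := ltn_trans p0 pq.
have alpha1 : (1 < alpha)%N.
  by rewrite ltnNge; apply/negP => le; have := leq_mul le (leqnn p); lia.
have alpha0 := ltnW alpha1.
have sP := sizeP_gt1 K p1.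
have sPQ := sizeQ_gt (1 : K) pq q_alpha.
have sQ := ltn_trans sP sPQ.
have [cN Xp] := CP1xCP1_passes sP sQ.
have Xa a b : X (affine_point a b) by apply/CP1xCP1E; constructor 1; exists a, b.
have Xi : X ((xL K)^-1, (yL K)^-1) by apply/CP1xCP1E; constructor 4.
have X1 : one_point D X := one_point_polynomial sP sQ Xa Xi cN Xp.
have Ez z : point_at X D (Some z) = _ := point_at_affine sP sQ Xa Xi cN Xp z.
have EN : point_at X D None = _ := point_at_None sP sQ Xa Xi cN Xp.
have iN : isolated D X None := isolated_None sP sQ Xa Xi cN Xp.
have i0 : isolated D X (Some 0).
  apply: (isolated_Some sP sQ Xa Xi cN Xp) => z; rewrite !hornerXn expr0n eqn0Ngt p0 /=.
  by move/eqP; rewrite expf_eq0 p0 => /eqP.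
have reg z : z != 0 -> smooth_at X D (Some z) /\ local_degree D X (Some z) = 0.
  by move=> z0; exact: (regular_affine char0 p1 pq cpq alpha1 q_alpha z0 (Ez z)).
have ap0 : (0 < alpha * p)%N by rewrite muln_gt0 alpha0.
have E0 : point_at X D (Some 0) = affine_point 0 0.
  rewrite Ez; congr (affine_point _ _); first by rewrite hornerXn expr0n eqn0Ngt p0.
  by rewrite hornerD hornerM hornerC !hornerXn !expr0n !eqn0Ngt q0 ap0 mulr0 addr0.
have b0 : equation_in_L D (base_chart K) != 0 := bicuspidal_base (1 : K) p1 pq cpq alpha1 q_alpha.
have g0 : germ D (Some 0) (affine_point 0 0) p q 0 :=
  germ_bicuspidal (1 : K) p1 pq cpq alpha1 q_alpha.
set e := (alpha * p - q)%N.
have e0 : (0 < e)%N by rewrite subn_gt0.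
have gN : tangent_germ D None p e _ alpha (2 * (alpha * p * p))%:Z :=
  tangent_germ_infty K p1 pq cpq q_alpha.
have Eqe : (q + e = alpha * p)%N by rewrite subnKC // ltnW.
have [r1 [r2 [tl1 tl2 Er]]] := euclid_tail_opp p1 pq e0 Eqe cpq.
have R0 := germ_resolvable b0 tl1 p0 q0 X1 i0 E0 g0.
have RN := tangent_germ_resolvable p1 e0 b0 tl2 alpha0 X1 iN EN gN.
have nsm0 : ~ smooth_at X D (Some 0) by move/(germ_smooth p0 q0 E0 g0); lia.
have nsmN : ~ smooth_at X D None.
  have [ru [rv [Lf _ _ _]]] := gN.
  move/(smooth_atE EN Lf).
  by rewrite (tangency_coef10 _ p1 e0 alpha0) (tangency_coef01 _ p1 e0 alpha0) eqxx => -[].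
have d0 := germ_degree b0 E0 g0.
have dN : local_degree D X None = (2 * (alpha * p * p))%:Z.
  by have [ru [rv [Lf _ _ _]]] := gN; exact: local_degree_eq b0 EN Lf.
have ppN : puiseux_pair X D None = _ := puiseux_CP1xCP1_infty p1 pq cpq q_alpha alpha1 EN.
have pp0 : puiseux_pair X D (Some 0) = (p, q).
  exact: puiseux_bicuspidal p1 pq cpq alpha1 _ E0.
have reg' s : s <> Some 0 -> s <> None -> smooth_at X D s /\ local_degree D X s = 0.
  case: s => [z|//] sz _; apply: reg; apply/eqP => z0; by rewrite z0 in sz.
have Eq2 : (2 * alpha * p - q = alpha * p + e)%N by rewrite -mulnA /e; lia.
have pe : (p < alpha * p + e)%N.
  have : (p <= alpha * p)%N by rewrite leq_pmull.
  lia.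
have M1 : (p * q + p * e = alpha * p * p)%N by rewrite -mulnDr Eqe mulnC.
have M2 : (p * (alpha * p + e) = alpha * p * p + p * e)%N.
  by rewrite mulnDr [(p * (alpha * p))%N]mulnC.
have M3 : (alpha * p * p = alpha * (p * p))%N by rewrite mulnA.
split.
  rewrite (gap_resolve _ R0 nsmN dN ppN reg') //.
  have cpe : coprime p (alpha * p + e).
    by rewrite -Eq2; apply: coprime_subMr => //; rewrite -mulnA; lia.
  have tlN : euclid_tail p (alpha * p + e) r2 by exact: euclid_tail_addn.
  rewrite Eq2 (m_euclid p1 pe cpe tlN).
  have -> : (alpha * p + e == p + 1)%N = false.
    apply/eqP; have : (2 * p <= alpha * p)%N by rewrite leq_mul2r alpha1 orbT.
    by lia.
  have -> : (p %| alpha * p + e + 1)%N = (p %| q - 1)%N.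
    have H : (alpha * p + e + 1 = 2 * alpha * p - (q - 1))%N by lia.
    by rewrite H dvdn_subr ?dvdn_mull //; lia.
  rewrite M2; move: Er M1; clear.
  move: ((2 < p)%N && (p %| q - 1)%N) ((2 < p)%N && (p %| q + 1)%N) => b1 b2.
  by move: (alpha * p * p)%N (p * e)%N (p * q)%N => *; lia.
rewrite (gap_resolve _ RN nsm0 d0 pp0 (fun s a b => reg' s b a)) //.
rewrite (m_euclid p1 pq cpq tl1).
rewrite -M3; move: Er M1; clear.
move: ((2 < p)%N && (p %| q - 1)%N) ((2 < p)%N && (p %| q + 1)%N) => b1 b2.
by move: (alpha * p * p)%N (p * e)%N (p * q)%N => *; lia.
Qed.
End CP1xCP1.
End Gaps.

(** p divides q - p + 1 and q - p divides p + 1, so p and q - p differ by at most 1. Equality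
    contradicts coprimality, and if they are consecutive, the smaller one divides 2. *)
Lemma mutually_exclusive_CP2 p q : (1 < p)%N -> (p < q)%N -> coprime p q ->
  (2 < p)%N -> (p %| q + 1)%N -> (2 < q - p)%N -> (q - p %| q + 1)%N -> False.
Proof.
move=> p1 pq cpq p2 d1 qp2 d2.
have E : (q + 1 = (q - p) + (p + 1))%N by lia.
have E' : (q + 1 = p + (q - p + 1))%N by lia.
rewrite E dvdn_addr // in d2; rewrite E' dvdn_addr // in d1.
have le1 : (p <= q - p + 1)%N by apply: dvdn_leq => //; lia.
have le2 : (q - p <= p + 1)%N by apply: dvdn_leq => //; lia.
have [H|H|H] := ltngtP p (q - p).
- have H1 : (q - p = p + 1)%N by lia.
  rewrite H1 -addnA dvdn_addr // in d1; have := dvdn_leq (isT : 0 < 1 + 1)%N d1; lia.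
- have H1 : (p = q - p + 1)%N by lia.
  rewrite {2}H1 -addnA dvdn_addr // in d2; have := dvdn_leq (isT : 0 < 1 + 1)%N d2; lia.
- have := coprime_multiple 2 p1; suff -> : (2 * p = q)%N by rewrite cpq.
  by lia.
Qed.

Theorem theorem1p5 (R : realType) :
  (forall p q : nat,
     (1 < p)%N -> (p < q)%N -> coprime p q -> (1 < q - p)%N ->
     let C : curve (complex R) := curve1 (complex R) p q in
     let X : surface (complex R) := CP2 (K := complex R) in
     let G0 : int := gap (resolve X C (Some 0)) C in
     let Ginf : int := gap (resolve X C None) C in
     let case_i : bool := (2 < p)%N && (p %| q + 1)%N in
     let case_ii : bool := (2 < q - p)%N && (q - p %| q + 1)%N in
     [/\ ~~ (case_i && case_ii),
         case_i -> G0 = 0 /\ Ginf = 1,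
         case_ii -> G0 = 1 /\ Ginf = 0
       & ~~ case_i -> ~~ case_ii -> G0 = 0 /\ Ginf = 0])
  /\
  (forall p q alpha : nat,
     (1 < p)%N -> (p < q)%N -> coprime p q ->
     (0 < alpha)%N -> (q < alpha * p)%N ->
     let C : curve (complex R) := curve2 (complex R) p q alpha in
     let X : surface (complex R) := CP1xCP1 (K := complex R) in
     let G0 : int := gap (resolve X C (Some 0)) C in
     let Ginf : int := gap (resolve X C None) C in
     let case_i : bool := (q - p == 1)%N in
     let case_ii : bool := (1 < q - p)%N && (p %| q - 1)%N in
     let case_iii : bool := (p %| q + 1)%N in
     [/\ (2 < p)%N ->
           [/\ [/\ ~~ (case_i && case_ii), ~~ (case_i && case_iii)
                 & ~~ (case_ii && case_iii)],
               case_i -> G0 = 0 /\ Ginf = 2,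
               case_ii -> G0 = 0 /\ Ginf = 1,
               case_iii -> G0 = 1 /\ Ginf = 0
             & ~~ case_i -> ~~ case_ii -> ~~ case_iii -> G0 = 0 /\ Ginf = 0],
         p = 2%N -> q = 3%N -> G0 = 0 /\ Ginf = 1
       & p = 2%N -> (3 < q)%N -> G0 = 0 /\ Ginf = 0]).
Proof.
have char0 n : n.+1%:R != 0 :> complex R by rewrite pnatr_eq0.
split=> [p q p1 pq cpq qp1 C X G0 Ginf ci cii|p q alpha p1 pq cpq a0 qa C X G0 Ginf ci cii ciii].
  have [E0 E1] := gap_CP2 char0 p1 pq cpq qp1.
  have excl : ~~ (ci && cii).
    apply/negP => /andP[/andP[p2 d1] /andP[qp2 d2]].
    exact: (mutually_exclusive_CP2 p1 pq cpq p2 d1 qp2 d2).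
  rewrite /G0 /Ginf /C /X E0 E1 -/ci -/cii; move: ci cii excl => [] [] //.
have [E0 E1] := gap_CP1xCP1 char0 p1 pq cpq qa.
rewrite /G0 /Ginf /C /X E0 E1 /ci /cii /ciii.
have dvd_diff : (2 < p)%N -> (p %| q - 1)%N -> (p %| q + 1)%N -> False.
  move=> p2 d1 d2; have : (q + 1 = (q - 1) + 2)%N by lia.
  move=> E; rewrite E dvdn_addr // in d2; have := dvdn_leq (isT : 0 < 2)%N d2; lia.
split=> [p2|p2 q3|p2 q3]; last 2 first.
(* For p = 2 the divisibility terms are switched off by the condition 2 < p; only the term for q = p
   + 1 is left. *)
- by rewrite p2 q3.
- by rewrite p2 /=; have -> : (q == 2 + 1)%N = false by apply/eqP; lia.
(* For q = p + 1 also p divides q - 1, so both terms of the gap at infinity are 1, which gives the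
   value 2. *)
rewrite p2 /=; have [Eq|nq] := eqVneq (q - p)%N 1%N.
  have Eq' : q = (p + 1)%N by lia.
  have d1 : (p %| q - 1)%N by rewrite Eq' addnK.
  have nd2 : (p %| q + 1)%N = false by apply/negP => /(dvd_diff p2 d1).
  by rewrite Eq nd2 d1 Eq' eqxx.
have nq' : (q == p + 1)%N = false by apply/eqP; move/eqP: nq; lia.
have qp1 : (1 < q - p)%N by move/eqP: nq; lia.
rewrite qp1 nq' /=; have [d1|nd1] := boolP (p %| q - 1)%N.
  by have -> : (p %| q + 1)%N = false by apply/negP => /(dvd_diff p2 d1).
by case: (p %| q + 1)%N.
Qed.
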